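(* If $k$ is a positive integer, then $$\log\mathcal{F}_k=-\left(k+\frac1k\right)\log\mathcal{A}+\frac1{12k}-\frac1{12k}\log k+\frac k4\log(2\pi)-\sum_{\nu=1}^{k-1}\frac{\nu}{k}\log\Gamma\!\left(\frac{\nu}{k}\right).$$
   Context: $\mathcal{A}$ is the Glaisher--Kinkelin constant, $\log\mathcal{A}=\frac1{12}-\zeta'(-1)$, where $\zeta$ is the Riemann zeta function. For a positive integer $k$, $\mathcal{F}_k>0$ denotes the (unique) real constant for which, as $n\to\infty$, $$\prod_{\nu=1}^n (k\nu)! \;\sim\; \mathcal{F}_k\,\mathcal{A}^k\,(2\pi)^{\frac14}\left(\frac{k\,n}{e^{3/2}}\right)^{\frac{k}{2}n(n+1)}\left(2\pi k e^{k/2-1}\,n\right)^{\frac n2} n^{\frac14+\frac{k}{12}+\frac1{12k}},$$ where $f\sim g$ means $f/g\to1$. *)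

(* Defs.v *)
From Stdlib Require Import Reals List Factorial ClassicalEpsilon.
From Coquelicot Require Import Coquelicot.
Open Scope R_scope.

Definition Cexp (z : C) : C :=
  (exp (Re z) * cos (Im z), exp (Re z) * sin (Im z)).

(* (n+1)^{-s} = exp (- s log (n+1)), so that the Dirichlet series starts at 1 *)
Definition dirichlet_term (s : C) (n : nat) : C :=
  Cexp (- s * RtoC (ln (INR (S n))))%C.

Definition analytic_at (f : C -> C) (z0 : C) : Prop :=
  exists (a : nat -> C) (r : R), 0 < r /\
    forall z : C, Cmod (z - z0)%C < r ->
      @is_pseries C_AbsRing C_NormedModule a (z - z0)%C (f z).

(* The Riemann zeta function is the analytic continuation to C \ {1} of the
   Dirichlet series; since C \ {1} is connected, this determines [zeta] off 1.
   Its value at the pole 1 is left unconstrained. *)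
Definition is_riemann_zeta (zeta : C -> C) : Prop :=
  (forall s : C, 1 < Re s ->
     @is_series C_AbsRing C_NormedModule (dirichlet_term s) (zeta s)) /\
  (forall s : C, s <> RtoC 1 -> analytic_at zeta s).

(* zeta'(-1) is a real number, so [Re] only changes its type *)
Definition glaisher (zeta : C -> C) : R :=
  exp (1 / 12 - Re (C_derive zeta (RtoC (-1)))).

(* Euler's integral, convergent for 0 < x *)
Definition Gamma (x : R) : R :=
  RInt_gen (fun t => Rpower t (x - 1) * exp (- t))
    (at_right 0) (Rbar_locally p_infty).

Definition prod_fact (k n : nat) : R :=
  fold_right Rmult 1 (map (fun nu => INR (fact (k * nu))) (seq 1 n)).

Definition prod_fact_asym (A F : R) (k n : nat) : R :=
  F * A ^ k * Rpower (2 * PI) (1 / 4)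
  * Rpower (INR k * INR n / exp (3 / 2)) (INR k / 2 * INR n * (INR n + 1))
  * Rpower (2 * PI * INR k * exp (INR k / 2 - 1) * INR n) (INR n / 2)
  * Rpower (INR n) (1 / 4 + INR k / 12 + 1 / (12 * INR k)).

Definition is_fact_const (A : R) (k : nat) (F : R) : Prop :=
  0 < F /\
  is_lim_seq (fun n => prod_fact k n / prod_fact_asym A F k n) 1.

(* The constant F_k; an equation on it also carries its existence, since nothing
   is known of [epsilon] at an unsatisfiable predicate. *)
Definition fact_const (A : R) (k : nat) : R :=
  epsilon (inhabits 0) (is_fact_const A k).

(* Main.v *)
Require Import Defs.
From Stdlib Require Import Reals Factorial List Lra Lia Classical ClassicalEpsilon.
From Coquelicot Require Import Coquelicot.
Open Scope R_scope.

(** Sorting the factors of the numbers (k nu)! by their residue modulo k gives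
    an exact formula (ln_prod_fact): with H(N) = sum over j <= N of j ln j,
    the logarithm of the product is
<<
      n ln (kn)! - H(kn) / k + sum_(v=1..k) (v/k) sum_(m<n) ln (km + v).
>>
    Three asymptotic expansions, each with its constant, then give the
    constant of the product.

    - ln N! is needed up to o(1/N), since it is multiplied by n.  Its constant
      ln (2 pi) / 2 comes from the Wallis integrals, and the next term 1/(12 N)
      accounts for 1/(12 k) (stirling).
    - The product of the m + x over m < n is Gamma (n + x) / Gamma x, and
      Gamma (n + x) is squeezed between n! (n + x)^(x-1) and n! n^(x-1) by the
      tangent-line bound for t^y under Euler's integral.  At x = v/k this
      produces the values ln Gamma (v/k) (gamma_gauss).
    - The constant in the expansion of H(N) is ln A = 1/12 - zeta'(-1)
      (glaisher_asymptotics).  This is where the zeta function enters.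

    For the third point only the Dirichlet series and local analyticity of zeta
    off 1 are given, so the value of zeta'(-1) has to be transported from the
    half-plane of convergence.  Summing the Dirichlet series by Euler--Maclaurin
    with H = x^(1-s) writes (s - 1) zeta(s) as a series of differences, each of
    size n^(-Re s - 4) up to a factor polynomial in s.  Expanded in powers of
    w = s - 3, the n-th difference has coefficients c(n,m) with
    sum_m |c(n,m)| 5^m = O(n^(-2)), so both sums may be interchanged and a single
    real power series of radius at least 5 represents (s - 1) zeta(s) for real s
    near 3.  Its disc contains -1, and the two segments from 3 to 1 + 2i and from
    1 + 2i to -1 stay in the disc and avoid the pole; the identity theorem along
    them shows that the series still represents (s - 1) zeta(s) near -1.  Value
    and derivative of the series at w = -4 are then limits of explicit partial
    sums, and those contain the sum of the j ln j. *)

(** * Interchanging limits and sums *)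

(** Equations obtained from lemmas on abstract structures are typed in the carrier
    of the structure; ring and field only see that carrier once it is folded to R. *)
Ltac real_eq := match goal with |- @eq _ ?a ?b => change (@eq R a b) end.

Lemma Series_tail_bound (a b : nat -> R) (N : nat) :
  (forall n, Rabs (a n) <= b n) -> ex_series b ->
  Rabs (Series a - sum_n a N) <= Series b - sum_n b N.
Proof.
  intros Hab Hb.
  assert (Ha : ex_series (fun n => Rabs (a n))).
  { apply (ex_series_le (fun n => Rabs (a n)) b); auto.
    intros n. change (Rabs (Rabs (a n)) <= b n). rewrite Rabs_Rabsolu. auto. }
  rewrite (Series_incr_n a (S N)); [| lia | now apply ex_series_Rabs].
  rewrite (Series_incr_n b (S N)); [| lia | auto].
  simpl pred. rewrite !sum_n_Reals.
  replace (sum_f_R0 a N + Series (fun k => a (S N + k)%nat) - sum_f_R0 a N)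
    with (Series (fun k => a (S N + k)%nat)) by ring.
  replace (sum_f_R0 b N + Series (fun k => b (S N + k)%nat) - sum_f_R0 b N)
    with (Series (fun k => b (S N + k)%nat)) by ring.
  eapply Rle_trans.
  - apply Series_Rabs. now apply (ex_series_incr_n (fun n => Rabs (a n)) (S N)).
  - apply Series_le; [| now apply (ex_series_incr_n b (S N))].
    intros n. split; [apply Rabs_pos | auto].
Qed.

(** Dominated convergence for series: beyond some N the tails are small uniformly in M
    because b is summable, and up to N there are finitely many limits to take. *)
Lemma tannery (f : nat -> nat -> R) (g b : nat -> R) :
  (forall n M, Rabs (f n M) <= b n) -> ex_series b ->
  (forall n, is_lim_seq (fun M => f n M) (g n)) ->
  is_lim_seq (fun M => Series (fun n => f n M)) (Series g).
Proof.
  intros Hf Hb Hg.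
  assert (Hgb : forall n, Rabs (g n) <= b n).
  { intros n.
    assert (H := is_lim_seq_abs _ _ (Hg n)).
    exact (is_lim_seq_le _ _ _ _ (Hf n) H (is_lim_seq_const (b n))). }
  apply is_lim_seq_spec. intros eps.
  assert (Hb' := Series_correct _ Hb).
  assert (He : 0 < eps / 4) by (destruct eps; simpl; lra).
  assert (H1 : is_lim_seq (sum_n b) (Series b)) by exact Hb'.
  apply is_lim_seq_spec in H1. destruct (H1 (mkposreal _ He)) as [N HN].
  specialize (HN N (Nat.le_refl N)). simpl in HN.
  assert (H2 : is_lim_seq (fun M => sum_n (fun n => f n M) N) (sum_n g N)).
  { clear HN. induction N as [|N IH].
    - rewrite sum_O. apply is_lim_seq_ext with (fun M => f 0%nat M); auto.
      intros M. now rewrite sum_O.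
    - rewrite sum_Sn. eapply is_lim_seq_ext.
      { intros M. symmetry. apply sum_Sn. }
      apply (is_lim_seq_plus' _ _ _ _ IH (Hg (S N))). }
  apply is_lim_seq_spec in H2. destruct (H2 (mkposreal _ He)) as [M0 HM0].
  exists M0. intros M HM. specialize (HM0 M HM). simpl in HM0.
  assert (T1 := Series_tail_bound (fun n => f n M) b N (fun n => Hf n M) Hb).
  assert (T2 := Series_tail_bound g b N Hgb Hb).
  apply Rabs_def2 in HN.
  apply Rabs_def2 in HM0.
  apply Rabs_le_between in T1. apply Rabs_le_between in T2.
  apply Rabs_def1; destruct eps; simpl in *; lra.
Qed.

Lemma Series_sum_n (u : nat -> nat -> R) (M : nat) :
  (forall m, ex_series (fun n => u n m)) ->
  is_series (fun n => sum_n (u n) M) (sum_n (fun m => Series (fun n => u n m)) M).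
Proof.
  intros H. induction M as [|M IH].
  - rewrite sum_O. apply is_series_ext with (fun n => u n 0%nat).
    { intros n. exact (eq_sym (sum_O (u n))). }
    now apply Series_correct.
  - rewrite sum_Sn.
    apply is_series_ext with (fun n => plus (sum_n (u n) M) (u n (S M))).
    { intros n. exact (eq_sym (sum_Sn (u n) M)). }
    apply (is_series_plus _ _ _ _ IH). now apply Series_correct.
Qed.

(** Fubini for an absolutely summable double array.  Truncating the rows at M gives
    sequences dominated by b, so tannery applies to the sum over n. *)
Lemma series_swap (u : nat -> nat -> R) (r b : nat -> R) :
  (forall n M, sum_n (fun m => Rabs (u n m)) M <= b n) -> ex_series b ->
  (forall n, is_series (u n) (r n)) ->
  (forall m, ex_series (fun n => u n m)) /\
  is_series (fun m => Series (fun n => u n m)) (Series r).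
Proof.
  intros Hu Hb Hr.
  assert (Hum : forall n m, Rabs (u n m) <= b n).
  { intros n m. eapply Rle_trans; [| apply (Hu n m)].
    destruct m; [rewrite sum_O; lra |].
    rewrite sum_Sn. unfold plus; simpl.
    assert (0 <= sum_n (fun k => Rabs (u n k)) m); [| lra].
    rewrite sum_n_Reals. apply cond_pos_sum. intros; apply Rabs_pos. }
  assert (Hc : forall m, ex_series (fun n => u n m)).
  { intros m. apply (ex_series_le (fun n => u n m) b); auto. }
  split; auto.
  change (is_lim_seq (sum_n (fun m => Series (fun n => u n m))) (Series r)).
  apply is_lim_seq_ext with (fun M => Series (fun n => sum_n (u n) M)).
  { intros M. apply is_series_unique. now apply Series_sum_n. }
  apply tannery with b; auto.
  intros n M. eapply Rle_trans; [| apply (Hu n M)].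
  rewrite !sum_n_Reals. apply Rsum_abs.
Qed.

Lemma ex_series_dominated (a b : nat -> R) :
  (forall n, 0 <= a n <= b n) -> ex_series b -> ex_series a.
Proof.
  intros H. apply (ex_series_le a b). intros n.
  change (Rabs (a n) <= b n). rewrite Rabs_pos_eq; apply H.
Qed.

(** * Power series over the complex numbers *)

(** Reduces convergence in C to convergence of real and imaginary parts, so that the
    real results on series apply. *)
Lemma is_series_C (a : nat -> C) (l : C) :
  @is_series C_AbsRing C_NormedModule a l <->
  is_series (fun n => Re (a n)) (Re l) /\ is_series (fun n => Im (a n)) (Im l).
Proof.
  assert (Hs : forall n, Re (sum_n (G := C_AbelianMonoid) a n) =
      sum_n (G := R_AbelianMonoid) (fun k => Re (a k)) n
    /\ Im (sum_n (G := C_AbelianMonoid) a n) =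
      sum_n (G := R_AbelianMonoid) (fun k => Im (a k)) n).
  { induction n as [|n [IH1 IH2]].
    - rewrite sum_O. rewrite !(sum_O (G := R_AbelianMonoid)). now split.
    - rewrite sum_Sn. rewrite !(sum_Sn (G := R_AbelianMonoid)).
      split; [exact (f_equal2 Rplus IH1 eq_refl) | exact (f_equal2 Rplus IH2 eq_refl)]. }
  unfold is_series. split.
  - intros H. split; apply filterlim_locally; intros eps;
    destruct (proj1 (filterlim_locally _ _) H eps) as [N HN];
    exists N; intros n Hn; destruct (HN n Hn) as [H1 H2].
    + change (ball (Re l) eps (Re (sum_n (G := C_AbelianMonoid) a n))) in H1.
      rewrite (proj1 (Hs n)) in H1. exact H1.
    + change (ball (Im l) eps (Im (sum_n (G := C_AbelianMonoid) a n))) in H2.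
      rewrite (proj2 (Hs n)) in H2. exact H2.
  - intros [H1 H2]. apply filterlim_locally. intros eps.
    destruct (proj1 (filterlim_locally _ _) H1 eps) as [N1 HN1].
    destruct (proj1 (filterlim_locally _ _) H2 eps) as [N2 HN2].
    exists (Nat.max N1 N2). intros n Hn. split.
    + change (ball (Re l) eps (Re (sum_n (G := C_AbelianMonoid) a n))).
      rewrite (proj1 (Hs n)). apply HN1. lia.
    + change (ball (Im l) eps (Im (sum_n (G := C_AbelianMonoid) a n))).
      rewrite (proj2 (Hs n)). apply HN2. lia.
Qed.

Definition CSeries (a : nat -> C) : C :=
  (Series (fun n => Re (a n)), Series (fun n => Im (a n))).

Lemma is_series_CSeries (a : nat -> C) :
  ex_series (fun n => Cmod (a n)) ->
  @is_series C_AbsRing C_NormedModule a (CSeries a).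
Proof.
  intros H. apply is_series_C. split; apply Series_correct;
  [apply (ex_series_le (fun n => Re (a n)) (fun n => Cmod (a n)))
  |apply (ex_series_le (fun n => Im (a n)) (fun n => Cmod (a n)))]; auto; intros n.
  - apply re_le_Cmod.
  - eapply Rle_trans; [| apply (Rmax_Cmod (a n))]. apply Rmax_r.
Qed.

Lemma is_series_C_eq (a : nat -> C) (l1 l2 : C) :
  @is_series C_AbsRing C_NormedModule a l1 ->
  @is_series C_AbsRing C_NormedModule a l2 -> l1 = l2.
Proof.
  intros H1 H2. apply is_series_C in H1. apply is_series_C in H2.
  destruct H1 as [A1 B1], H2 as [A2 B2].
  destruct l1, l2; simpl in *. f_equal.
  - rewrite <- (is_series_unique _ _ A1). exact (is_series_unique _ _ A2).
  - rewrite <- (is_series_unique _ _ B1). exact (is_series_unique _ _ B2).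
Qed.

Lemma series_swap_C (u : nat -> nat -> C) (r : nat -> C) (b : nat -> R) :
  (forall n M, sum_n (fun m => Cmod (u n m)) M <= b n) -> ex_series b ->
  (forall n, @is_series C_AbsRing C_NormedModule (u n) (r n)) ->
  @is_series C_AbsRing C_NormedModule
    (fun m => CSeries (fun n => u n m)) (CSeries r).
Proof.
  intros Hu Hb Hr. apply is_series_C. simpl.
  assert (Hle : forall (p : C -> R), (forall c, Rabs (p c) <= Cmod c) ->
    forall n M, sum_n (fun m => Rabs (p (u n m))) M <= b n).
  { intros p Hp n M. eapply Rle_trans; [| apply (Hu n M)].
    rewrite !sum_n_Reals. apply sum_Rle. intros; apply Hp. }
  split.
  - apply (series_swap (fun n m => Re (u n m)) (fun n => Re (r n)) b); auto.
    + apply Hle. apply re_le_Cmod.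
    + intros n. apply (proj1 (is_series_C _ _) (Hr n)).
  - apply (series_swap (fun n m => Im (u n m)) (fun n => Im (r n)) b); auto.
    + apply Hle. intros c. eapply Rle_trans; [| apply (Rmax_Cmod c)]. apply Rmax_r.
    + intros n. apply (proj1 (is_series_C _ _) (Hr n)).
Qed.

(** The coefficient of w^j in (z + w)^m.  The recursion, which multiplies by z + w,
    makes both the generating identity and the absolute bound immediate inductions. *)
Fixpoint shift_coef (z : C) (m : nat) : nat -> C :=
  match m with
  | O => fun j => match j with O => RtoC 1 | _ => RtoC 0 end
  | S m' => fun j => (z * shift_coef z m' j +
      match j with O => RtoC 0 | S j' => shift_coef z m' j' end)%C
  end.

Lemma is_pseries_C (a : nat -> C) (w l : C) :
  @is_pseries C_AbsRing C_NormedModule a w l <->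
  @is_series C_AbsRing C_NormedModule (fun n => (a n * w ^ n)%C) l.
Proof.
  assert (E : forall n, (a n * w ^ n)%C =
    @scal C_AbsRing C_NormedModule (@pow_n C_AbsRing w n) (a n)).
  { intros n. apply Cmult_comm. }
  split; [apply is_series_ext; intros n; symmetry | apply is_series_ext; intros n];
  apply E.
Qed.

Lemma shift_coef_sum (z w : C) (m : nat) :
  @is_series C_AbsRing C_NormedModule
    (fun j => (shift_coef z m j * w ^ j)%C) ((z + w) ^ m)%C.
Proof.
  apply (proj1 (is_pseries_C (shift_coef z m) w _)). induction m as [|m IH].
  - apply (proj2 (is_pseries_C _ w _)). apply is_series_decr_1.
    replace (plus _ _) with (zero : C_NormedModule).
    + apply filterlim_ext with (fun _ : nat => zero : C_NormedModule).
      { intros n. symmetry. induction n as [|n IHn].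
        - rewrite sum_O. apply Cmult_0_l.
        - rewrite sum_Sn, IHn. simpl. rewrite Cmult_0_l. apply plus_zero_l. }
      apply filterlim_const.
    + unfold plus, opp, zero; simpl. ring.
  - apply is_pseries_ext with
      (PS_plus (PS_scal (V := C_NormedModule) z (shift_coef z m))
               (PS_incr_1 (shift_coef z m))).
    { intros [|j]; reflexivity. }
    replace ((z + w) ^ S m)%C with (plus (scal z ((z + w) ^ m)%C : C_NormedModule)
      (scal w ((z + w) ^ m)%C)).
    + apply is_pseries_plus.
      * apply (@is_pseries_scal C_AbsRing C_NormedModule); [apply Cmult_comm | exact IH].
      * apply (@is_pseries_incr_1 C_AbsRing C_NormedModule). exact IH.
    + simpl. unfold plus, scal; simpl. unfold mult; simpl. ring.
Qed.

(** Absolute version of the binomial formula: this is what makes re-expansion at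
    another centre an absolutely summable double series. *)
Lemma shift_coef_abs (z : C) (r : R) (m J : nat) : 0 <= r ->
  sum_n (fun j => Cmod (shift_coef z m j) * r ^ j) J <= (Cmod z + r) ^ m.
Proof.
  intros Hr. revert J. induction m as [|m IH]; intros J.
  - assert (E : sum_n (fun j => Cmod (shift_coef z 0 j) * r ^ j) J = 1).
    { induction J as [|J IHJ].
      - rewrite sum_O. simpl. rewrite Cmod_1. ring.
      - rewrite sum_Sn, IHJ. unfold plus; simpl. rewrite Cmod_0. ring. }
    rewrite E. simpl. lra.
  - apply Rle_trans with
      (Cmod z * sum_n (fun j => Cmod (shift_coef z m j) * r ^ j) J
       + r * match J with O => 0
             | S J' => sum_n (fun j => Cmod (shift_coef z m j) * r ^ j) J' end).
    + induction J as [|J IHJ].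
      * rewrite !sum_O. simpl. rewrite Cplus_0_r, Cmod_mult. lra.
      * rewrite !(sum_Sn _ J). unfold plus; simpl.
        assert (T := Cmod_triangle (z * shift_coef z m (S J)) (shift_coef z m J)).
        rewrite Cmod_mult in T.
        assert (P : 0 <= r * r ^ J) by (apply Rmult_le_pos; [| apply pow_le]; lra).
        assert (Q := Rmult_le_compat_r _ _ _ P T).
        destruct J as [|J].
        -- rewrite !sum_O in *. simpl in *. lra.
        -- rewrite (sum_Sn (fun j => Cmod (shift_coef z m j) * r ^ j) J) in *.
           unfold plus in *; simpl in *. lra.
    + simpl. rewrite Rmult_plus_distr_r.
      apply Rplus_le_compat; (apply Rmult_le_compat_l; [auto using Cmod_ge_0 |]).
      * apply IH.
      * destruct J; [| apply IH]. apply pow_le. generalize (Cmod_ge_0 z); lra.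
Qed.

(** A power series is analytic in the whole interior of its disc: expand each
    (v + w)^m and interchange the two sums, which is allowed while |v| + |w| < rho. *)
Lemma analytic_at_recenter (c : nat -> C) (s0 : C) (rho : R) (g : C -> C) :
  ex_series (fun m => Cmod (c m) * rho ^ m) ->
  (forall s, Cmod (s - s0)%C < rho ->
     @is_pseries C_AbsRing C_NormedModule c (s - s0)%C (g s)) ->
  forall z, Cmod (z - s0)%C < rho -> analytic_at g z.
Proof.
  intros Hc Hg z Hz.
  set (v := (z - s0)%C) in *. set (r := rho - Cmod v).
  assert (Hr : 0 < r) by (unfold r; lra).
  assert (Hb : forall m J, sum_n (fun j => Cmod (shift_coef v m j) * r ^ j) J <= rho ^ m).
  { intros m J. replace rho with (Cmod v + r) by (unfold r; ring).
    apply shift_coef_abs; lra. }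
  assert (Hb1 : forall m j, Cmod (shift_coef v m j) * r ^ j <= rho ^ m).
  { intros m j. eapply Rle_trans; [| apply (Hb m j)].
    destruct j; [rewrite sum_O; lra |]. rewrite sum_Sn. unfold plus; simpl.
    match goal with |- _ <= ?s + _ => assert (0 <= s); [| lra] end.
    rewrite sum_n_Reals. apply cond_pos_sum. intros; apply Rmult_le_pos;
      [apply Cmod_ge_0 | apply pow_le; lra]. }
  exists (fun j => CSeries (fun m => (c m * shift_coef v m j)%C)), r.
  split; auto. intros s Hs. set (w := (s - z)%C) in *.
  assert (Hrow : forall m, @is_series C_AbsRing C_NormedModule
    (fun j => (c m * (shift_coef v m j * w ^ j))%C) (c m * (v + w) ^ m)%C).
  { intros m. apply (@is_series_scal C_AbsRing C_NormedModule (c m)).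
    apply shift_coef_sum. }
  assert (Hsum := series_swap_C (fun m j => (c m * (shift_coef v m j * w ^ j))%C)
    (fun m => (c m * (v + w) ^ m)%C) (fun m => Cmod (c m) * rho ^ m)).
  assert (Hsv : (s - s0)%C = (v + w)%C) by (unfold v, w; ring).
  assert (Hgs : @is_pseries C_AbsRing C_NormedModule c (v + w)%C (g s)).
  { rewrite <- Hsv. apply Hg. rewrite Hsv.
    eapply Rle_lt_trans; [apply Cmod_triangle |]. unfold r in Hs. lra. }
  apply is_pseries_C in Hgs.
  assert (Hub : forall m M, sum_n (fun j => Cmod (c m * (shift_coef v m j * w ^ j))) M
     <= Cmod (c m) * rho ^ m).
  { intros m M. eapply Rle_trans;
      [| apply Rmult_le_compat_l; [apply Cmod_ge_0 | apply (Hb m M)]].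
    rewrite <- (sum_n_mult_l (K := R_Ring)).
    rewrite !sum_n_Reals. apply sum_Rle. intros j _.
    rewrite !Cmod_mult, Cmod_pow. unfold mult; simpl.
    apply Rmult_le_compat_l; [apply Cmod_ge_0 |].
    apply Rmult_le_compat_l; [apply Cmod_ge_0 |].
    apply pow_incr. split; [apply Cmod_ge_0 | lra]. }
  specialize (Hsum Hub Hc Hrow).
  assert (Hval : CSeries (fun m => (c m * (v + w) ^ m)%C) = g s).
  { eapply is_series_C_eq; [| exact Hgs]. apply is_series_CSeries.
    eapply ex_series_dominated; [| exact Hc]. intros m.
    split; [apply Cmod_ge_0 |]. rewrite Cmod_mult, Cmod_pow.
    apply Rmult_le_compat_l; [apply Cmod_ge_0 |].
    apply pow_incr. split; [apply Cmod_ge_0 |].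
    eapply Rle_trans; [apply Cmod_triangle |]. unfold r in Hs. lra. }
  rewrite Hval in Hsum.
  apply is_pseries_C. eapply is_series_ext; [| exact Hsum].
  intros j. simpl. symmetry.
  eapply is_series_C_eq.
  - rewrite Cmult_comm. apply (@is_series_scal C_AbsRing C_NormedModule (w ^ j)%C).
    apply is_series_CSeries.
    apply (ex_series_dominated _ (fun m => Cmod (c m) * rho ^ m * (/ r ^ j))).
    + intros m. split; [apply Cmod_ge_0 |]. rewrite Cmod_mult, Rmult_assoc.
      apply Rmult_le_compat_l; [apply Cmod_ge_0 |].
      apply Rmult_le_reg_r with (r ^ j); [now apply pow_lt |].
      rewrite Rmult_assoc, Rinv_l by (apply pow_nonzero; lra). 
      rewrite Rmult_1_r. apply Hb1.
    + now apply ex_series_scal_r.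
  - eapply is_series_ext; [| apply is_series_CSeries].
    + intros m. simpl. change (c m * (shift_coef v m j * w ^ j) = w ^ j * (c m * shift_coef v m j))%C.
      ring.
    + eapply ex_series_dominated; [| exact Hc]. intros m.
      split; [apply Cmod_ge_0 |].
      rewrite !Cmod_mult, Cmod_pow. apply Rmult_le_compat_l; [apply Cmod_ge_0 |].
      eapply Rle_trans; [| apply (Hb1 m j)].
      apply Rmult_le_compat_l; [apply Cmod_ge_0 |].
      apply pow_incr. split; [apply Cmod_ge_0 | lra].
Qed.

(** A term is the difference of two partial sums, and these are bounded. *)
Lemma pseries_coef_bounded (a : nat -> C) (w l : C) :
  @is_pseries C_AbsRing C_NormedModule a w l ->
  exists M, forall n, Cmod (a n) * Cmod w ^ n <= M.
Proof.
  intros H. apply is_pseries_C in H.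
  destruct (@filterlim_bounded C_AbsRing C_NormedModule
     (sum_n (G := C_AbelianMonoid) (fun n => (a n * w ^ n)%C))) as [M HM].
  { exists l. exact H. }
  exists (M + M). intros n. rewrite <- Cmod_pow, <- Cmod_mult.
  assert (Hn := HM n). change norm with Cmod in *.
  assert (HM' : forall n, Cmod (sum_n (G := C_AbelianMonoid) (fun n => (a n * w ^ n)%C) n) <= M) by exact HM.
  destruct n as [|n].
  - specialize (HM' O). rewrite sum_O in HM'.
    generalize (Cmod_ge_0 (a O * w ^ O)); lra.
  - assert (H1 := HM' n). assert (H2 := HM' (S n)).
    rewrite sum_Sn in H2.
    set (p := sum_n (G := C_AbelianMonoid) (fun n => (a n * w ^ n)%C) n) in *.
    set (q := (a (S n) * w ^ S n)%C) in *.
    change (Cmod (p + q) <= M) in H2.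
    replace q with ((p + q) + - p)%C by ring.
    eapply Rle_trans; [apply Cmod_triangle |]. rewrite Cmod_opp. lra.
Qed.

(** With |a n| rho^n <= M the tail from n = 1 on is at most a geometric series of
    ratio |w| / rho <= 1/2. *)
Lemma pseries_first_order (a : nat -> C) (rho M : R) (w l : C) :
  0 < rho -> (forall n, Cmod (a n) * rho ^ n <= M) -> Cmod w <= rho / 2 ->
  @is_pseries C_AbsRing C_NormedModule a w l ->
  Cmod (l - a O)%C <= 2 * M / rho * Cmod w.
Proof.
  intros Hrho HM Hw H. apply is_pseries_C in H.
  set (q := Cmod w / rho).
  assert (Hq0 : 0 <= q) by (apply Rdiv_le_0_compat; [apply Cmod_ge_0 | lra]).
  assert (Hq1 : q <= 1 / 2).
  { unfold q. apply Rmult_le_reg_r with rho; auto. unfold Rdiv.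
    rewrite Rmult_assoc, Rinv_l by lra. lra. }
  replace (2 * M / rho * Cmod w) with (2 * M * q) by (unfold q; field; lra).
  assert (HM0 : 0 <= M).
  { eapply Rle_trans; [| apply (HM O)]. rewrite pow_O, Rmult_1_r. apply Cmod_ge_0. }
  assert (Hp : forall N, Cmod (sum_n (G := C_AbelianMonoid) (fun n => (a n * w ^ n)%C) N - a O)%C
     <= 2 * M * q * (1 - (/ 2) ^ N)).
  { induction N as [|N IH].
    - rewrite sum_O. replace (a O * w ^ O - a O)%C with (RtoC 0) by (simpl; ring).
      rewrite Cmod_0. simpl. lra.
    - rewrite sum_Sn.
      set (p := sum_n (G := C_AbelianMonoid) (fun n => (a n * w ^ n)%C) N) in *.
      change (Cmod ((p + a (S N) * w ^ S N) - a O) <= 2 * M * q * (1 - (/ 2) ^ S N)).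
      replace ((p + a (S N) * w ^ S N) - a O)%C with ((p - a O) + a (S N) * w ^ S N)%C by ring.
      eapply Rle_trans; [apply Cmod_triangle |]. rewrite Cmod_mult, Cmod_pow.
      assert (T : Cmod (a (S N)) * Cmod w ^ S N <= M * q * (/ 2) ^ N).
      { replace (Cmod w) with (rho * q) by (unfold q; field; lra).
        rewrite Rpow_mult_distr, <- Rmult_assoc, Rmult_assoc.
        apply Rle_trans with (M * q ^ S N).
        - rewrite <- Rmult_assoc. apply Rmult_le_compat_r; auto. apply pow_le; auto.
        - rewrite Rmult_assoc. apply Rmult_le_compat_l; auto. simpl.
          apply Rmult_le_compat_l; auto. apply pow_incr. lra. }
      simpl. simpl in T. lra. }
  assert (L : is_lim_seq (fun N => Cmod (sum_n (G := C_AbelianMonoid) (fun n => (a n * w ^ n)%C) N - a O)%C)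
     (Cmod (l - a O))).
  { apply (filterlim_comp _ _ _ (fun N => (sum_n (G := C_AbelianMonoid) (fun n => (a n * w ^ n)%C) N - a O)%C) Cmod _ (locally (T := C_NormedModule) (l - a O)%C)).
    - apply (filterlim_comp_2 (G := locally (T := C_NormedModule) l) (H := locally (T := C_NormedModule) (- a O)%C)
        (sum_n (G := C_AbelianMonoid) (fun n => (a n * w ^ n)%C)) (fun _ => (- a O)%C) Cplus).
      + exact H.
      + apply filterlim_const.
      + apply (@filterlim_plus C_AbsRing C_NormedModule).
    - apply (@filterlim_norm C_AbsRing C_NormedModule). }
  refine (is_lim_seq_le _ (fun _ => 2 * M * q) _ (Finite _) _ L (is_lim_seq_const _)).
  intros N. eapply Rle_trans; [apply Hp |].
  assert (0 <= (/ 2) ^ N) by (apply pow_le; lra).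
  assert (0 <= M * q) by now apply Rmult_le_pos.
  nra.
Qed.

(** * The identity theorem along a segment *)

Definition zeros_cluster (f : C -> C) (z0 : C) : Prop :=
  forall d, 0 < d -> exists z, 0 < Cmod (z - z0)%C < d /\ f z = RtoC 0.

Definition agree_near (f g : C -> C) (z0 : C) : Prop :=
  exists d, 0 < d /\ forall z, Cmod (z - z0)%C < d -> f z = g z.

Lemma Cmod_pos_neq (w : C) : 0 < Cmod w -> w <> RtoC 0.
Proof. intros H E. rewrite E, Cmod_0 in H. lra. Qed.

(** At zeros w tending to 0 the bound |f w - a 0| = O(|w|) leaves a 0 = 0. *)
Lemma pseries_zeros_const (a : nat -> C) (r : R) (f : C -> C) :
  0 < r ->
  (forall w, Cmod w < r -> @is_pseries C_AbsRing C_NormedModule a w (f w)) ->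
  zeros_cluster f (RtoC 0) -> a O = RtoC 0.
Proof.
  intros Hr Hf Hz.
  set (rho := r / 2).
  destruct (pseries_coef_bounded a (RtoC rho) (f (RtoC rho))) as [M HM].
  { apply Hf. rewrite Cmod_R, Rabs_pos_eq; unfold rho; lra. }
  rewrite Cmod_R, Rabs_pos_eq in HM by (unfold rho; lra).
  assert (HM0 : 0 <= M).
  { eapply Rle_trans; [| apply (HM O)]. rewrite pow_O, Rmult_1_r. apply Cmod_ge_0. }
  apply Cmod_eq_0. apply Rle_antisym; [| apply Cmod_ge_0].
  apply le_epsilon. intros eps He. rewrite Rplus_0_l.
  (* The summand 1 keeps K positive when M = 0. *)
  set (K := 2 * M / rho + 1).
  assert (HK : 0 < K).
  { assert (0 <= 2 * M / rho); [| unfold K; lra].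
    apply Rdiv_le_0_compat; unfold rho; lra. }
  destruct (Hz (Rmin (rho / 2) (eps / K))) as [w [[Hw1 Hw2] Hw3]].
  { apply Rmin_glb_lt; [unfold rho; lra |]. now apply Rdiv_lt_0_compat. }
  replace (w - RtoC 0)%C with w in * by ring.
  assert (H1 := Rlt_le_trans _ _ _ Hw2 (Rmin_l _ _)).
  assert (H2 := Rlt_le_trans _ _ _ Hw2 (Rmin_r _ _)).
  assert (T : Cmod (RtoC 0 - a O)%C <= 2 * M / rho * Cmod w).
  { rewrite <- Hw3. apply pseries_first_order; auto; [unfold rho; lra | lra |].
    apply Hf. unfold rho in H1. lra. }
  replace (RtoC 0 - a O)%C with (- a O)%C in T by ring. rewrite Cmod_opp in T.
  apply Rle_trans with (1 := T). apply Rle_trans with (K * Cmod w).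
  + apply Rmult_le_compat_r; unfold K; lra.
  + apply Rmult_lt_compat_l with (r := K) in H2; auto.
    replace (K * (eps / K)) with eps in H2 by (field; lra). lra.
Qed.

(** Zeros are isolated: once a 0 = 0, dividing by w gives a power series with the same
    nonzero zeros, and its constant term is the next coefficient. *)
Lemma pseries_zeros_coef (n : nat) : forall (a : nat -> C) (r : R) (f : C -> C),
  0 < r ->
  (forall w, Cmod w < r -> @is_pseries C_AbsRing C_NormedModule a w (f w)) ->
  zeros_cluster f (RtoC 0) -> a n = RtoC 0.
Proof.
  induction n as [|n IH]; intros a r f Hr Hf Hz.
  - now apply (pseries_zeros_const a r f).
  - assert (H0 : a O = RtoC 0).
    { now apply (pseries_zeros_const a r f). }
    set (f' := fun w => if excluded_middle_informative (w = RtoC 0) then a 1%nat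
                        else (/ w * f w)%C).
    apply (IH (PS_decr_1 a) r f'); auto.
    + intros w Hw. unfold f'. destruct excluded_middle_informative as [E | E].
      * rewrite E. apply (is_pseries_0 (V := C_NormedModule) (PS_decr_1 a)).
      * replace (/ w * f w)%C with
          (@scal C_AbsRing C_NormedModule (/ w)%C (plus (f w) (opp (a O)))).
        -- apply (@is_pseries_decr_1 C_AbsRing C_NormedModule); [now apply Cinv_l | now apply Hf].
        -- rewrite H0. unfold scal, plus, opp; simpl. unfold mult; simpl. ring.
    + intros d Hd. destruct (Hz d Hd) as [w [Hw1 Hw2]]. exists w. split; auto.
      unfold f'. destruct excluded_middle_informative as [E | E].
      * exfalso. apply (Cmod_pos_neq w); auto.
        replace (w - RtoC 0)%C with w in Hw1 by ring. apply Hw1.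
      * rewrite Hw2. ring.
Qed.

Lemma analytic_identity_local (f g : C -> C) (z0 : C) :
  analytic_at f z0 -> analytic_at g z0 ->
  zeros_cluster (fun z => f z - g z)%C z0 -> agree_near f g z0.
Proof.
  intros [a [ra [Hra Ha]]] [b [rb [Hrb Hb]]] Hz.
  set (r := Rmin ra rb).
  assert (Hr : 0 < r) by (now apply Rmin_glb_lt).
  set (h := fun w => (f (z0 + w) - g (z0 + w))%C).
  set (c := PS_plus (V := C_NormedModule) a (PS_opp b)).
  assert (Hc : forall w, Cmod w < r -> @is_pseries C_AbsRing C_NormedModule c w (h w)).
  { intros w Hw. unfold c, h. apply (@is_pseries_plus C_AbsRing C_NormedModule).
    - replace w with ((z0 + w) - z0)%C at 1 by ring. apply Ha.
      replace (z0 + w - z0)%C with w by ring.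
      eapply Rlt_le_trans; [exact Hw | apply Rmin_l].
    - apply (@is_pseries_opp C_AbsRing C_NormedModule).
      replace w with ((z0 + w) - z0)%C at 1 by ring. apply Hb.
      replace (z0 + w - z0)%C with w by ring.
      eapply Rlt_le_trans; [exact Hw | apply Rmin_r]. }
  assert (Hc0 : forall n, c n = RtoC 0).
  { intros n. apply (pseries_zeros_coef n c r h); auto.
    intros d Hd. destruct (Hz d Hd) as [z [H1 H2]]. exists (z - z0)%C.
    replace (z - z0 - RtoC 0)%C with (z - z0)%C by ring. split; auto.
    unfold h. replace (z0 + (z - z0))%C with z by ring. exact H2. }
  exists r. split; auto. intros z Hzr.
  specialize (Hc _ Hzr). apply is_pseries_C in Hc.
  assert (E : h (z - z0)%C = RtoC 0).
  { eapply is_series_C_eq; [exact Hc |].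
    apply filterlim_ext with (fun _ : nat => zero : C_NormedModule).
    - intros n. symmetry. induction n as [|n IHn].
      + rewrite sum_O, Hc0. apply Cmult_0_l.
      + rewrite sum_Sn, IHn, Hc0.
        change (RtoC 0 + RtoC 0 * (z - z0) ^ S n = RtoC 0)%C. ring.
    - apply filterlim_const. }
  unfold h in E. replace (z0 + (z - z0))%C with z in E by ring.
  replace (f z) with ((f z - g z) + g z)%C by ring. rewrite E. ring.
Qed.

(** The parameters at which f and g agree locally form an open set by definition,
    and a closed one because points of agreement clustering at an analytic point
    force agreement there.  The indicator of that set is thus locally constant on
    [0,1]: its derivative vanishes, so it takes the same value at both ends. *)
Lemma analytic_identity_segment (f g : C -> C) (z0 z1 : C) :
  z0 <> z1 ->
  (forall u : R, 0 <= u <= 1 ->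
     analytic_at f (z0 + RtoC u * (z1 - z0))%C /\
     analytic_at g (z0 + RtoC u * (z1 - z0))%C) ->
  agree_near f g z0 -> agree_near f g z1.
Proof.
  intros Hne Han H0.
  set (gam := fun u : R => (z0 + RtoC u * (z1 - z0))%C) in *.
  set (L := Cmod (z1 - z0)%C).
  assert (HL : 0 < L).
  { apply Cmod_gt_0. intros E. apply Hne.
    replace z1 with ((z1 - z0) + z0)%C by ring. rewrite E. ring. }
  assert (Hdist : forall u v, Cmod (gam u - gam v)%C = Rabs (u - v) * L).
  { intros u v. unfold gam, L. rewrite <- Cmod_R, <- Cmod_mult. f_equal.
    rewrite RtoC_minus. ring. }
  set (P := fun u => agree_near f g (gam u)).
  assert (Hopen : forall u, P u -> exists e, 0 < e /\ forall v, Rabs (v - u) < e -> P v).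
  { intros u [d [Hd Hu]]. exists (d / 2 / L). split.
    { apply Rdiv_lt_0_compat; lra. }
    intros v Hv. exists (d / 2). split; [lra |]. intros z Hz. apply Hu.
    replace (z - gam u)%C with ((z - gam v) + (gam v - gam u))%C by ring.
    eapply Rle_lt_trans; [apply Cmod_triangle |]. rewrite Hdist.
    apply Rmult_lt_compat_r with (r := L) in Hv; auto.
    replace (d / 2 / L * L) with (d / 2) in Hv by (field; lra). lra. }
  set (chi := fun u => if excluded_middle_informative (P u) then 1 else 0).
  assert (Hchi : forall t, 0 <= t <= 1 -> is_derive chi t zero).
  { intros t Ht.
    assert (Hloc : exists e, 0 < e /\ forall v, Rabs (v - t) < e -> chi t = chi v).
    { unfold chi. destruct (excluded_middle_informative (P t)) as [Pt | nPt].
      - destruct (Hopen t Pt) as [e [He Hv]]. exists e. split; auto.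
        intros v Hvt. destruct excluded_middle_informative; auto.
        exfalso; auto.
      - apply NNPP. intros Hno. apply nPt.
        apply analytic_identity_local; try apply Han; auto.
        intros d Hd. apply NNPP. intros Hno2. apply Hno.
        exists (d / L). split; [now apply Rdiv_lt_0_compat |].
        intros v Hv. destruct excluded_middle_informative as [Pv | _]; auto.
        exfalso. destruct (Req_dec v t) as [-> | Hvt]; [auto |].
        apply Hno2. exists (gam v). rewrite Hdist. split.
        + split.
          * apply Rmult_lt_0_compat; auto. apply Rabs_pos_lt. lra.
          * apply Rmult_lt_compat_r with (r := L) in Hv; auto.
            now replace (d / L * L) with d in Hv by (field; lra).
        + destruct Pv as [dv [Hdv Hv']]. rewrite (Hv' (gam v)).
          * ring.
          * replace (gam v - gam v)%C with (RtoC 0) by ring. now rewrite Cmod_0. }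
    destruct Hloc as [e [He Hv]].
    apply is_derive_ext_loc with (fun _ => chi t).
    - exists (mkposreal e He). intros v Hball. apply Hv. exact Hball.
    - apply is_derive_const. }
  assert (E : chi 0 = chi 1) by (apply eq_is_derive; [exact Hchi | lra]).
  unfold chi in E.
  assert (P0 : P 0).
  { unfold P, gam. replace (z0 + RtoC 0 * (z1 - z0))%C with z0 by ring. exact H0. }
  destruct (excluded_middle_informative (P 0)); [| contradiction].
  destruct (excluded_middle_informative (P 1)) as [P1 | ]; [| lra].
  unfold P, gam in P1. now replace (z0 + RtoC 1 * (z1 - z0))%C with z1 in P1 by ring.
Qed.

(** * One Euler--Maclaurin step and the Taylor coefficients of x^(1-s) *)

Lemma bound_from_derivative (f g : R -> R) (B : R) :
  f 0 = 0 ->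
  (forall t, 0 <= t <= 1 -> is_derive f t (g t)) ->
  (forall t, 0 <= t <= 1 -> Rabs (g t) <= B) ->
  forall t, 0 <= t <= 1 -> Rabs (f t) <= B.
Proof.
  intros H0 Hd Hg t Ht.
  destruct (MVT_gen f 0 t g) as [c [Hc E]].
  - intros x Hx. rewrite Rmin_left, Rmax_right in Hx by lra. apply Hd. lra.
  - intros x Hx. rewrite Rmin_left, Rmax_right in Hx by lra.
    apply derivable_continuous_pt. exists (g x). apply is_derive_Reals. apply Hd. lra.
  - rewrite Rmin_left, Rmax_right in Hc by lra.
    rewrite H0, !Rminus_0_r in E. rewrite E, Rabs_mult, (Rabs_pos_eq t) by lra.
    assert (T := Hg c ltac:(lra)). assert (T2 := Rabs_pos (g c)). nra.
Qed.

(** As a function of the step length t the error phi0 vanishes to third order at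
    0 and its third derivative is t^2/12 H^(5)(a + t); integrate the bound three times. *)
Lemma euler_maclaurin_step (H : nat -> R -> R) (a B : R) :
  (forall j x, (j < 5)%nat -> a <= x <= a + 1 -> is_derive (H j) x (H (S j) x)) ->
  (forall x, a <= x <= a + 1 -> Rabs (H 5%nat x) <= B) ->
  Rabs (H O (a + 1) - H O a - (H 1%nat a + H 1%nat (a + 1)) / 2
        + (H 2%nat (a + 1) - H 2%nat a) / 12) <= B.
Proof.
  intros HD HB.
  set (phi0 := fun t => H O (a + t) - H O a - t / 2 * (H 1%nat a + H 1%nat (a + t))
     + t ^ 2 / 12 * (H 2%nat (a + t) - H 2%nat a)).
  set (phi1 := fun t => (H 1%nat (a + t) - H 1%nat a) / 2 - t / 3 * H 2%nat (a + t)
     - t / 6 * H 2%nat a + t ^ 2 / 12 * H 3%nat (a + t)).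
  set (phi2 := fun t => (H 2%nat (a + t) - H 2%nat a) / 6 - t / 6 * H 3%nat (a + t)
     + t ^ 2 / 12 * H 4%nat (a + t)).
  set (phi3 := fun t => t ^ 2 / 12 * H 5%nat (a + t)).
  (* phi1, phi2, phi3 are the successive derivatives of phi0. *)
  assert (B3 : forall t, 0 <= t <= 1 -> Rabs (phi3 t) <= B).
  { intros t Ht. unfold phi3. assert (T := HB (a + t) ltac:(lra)).
    assert (T3 : 0 <= t ^ 2 / 12 <= 1) by (split; simpl; nra).
    rewrite Rabs_mult, (Rabs_pos_eq (t ^ 2 / 12)) by apply T3.
    assert (T2 := Rabs_pos (H 5%nat (a + t))).
    apply Rle_trans with (1 * Rabs (H 5%nat (a + t))); [| lra].
    apply Rmult_le_compat_r; lra. }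
  assert (X : forall j t, (j < 5)%nat -> 0 <= t <= 1 -> ex_derive (H j) (a + t)
     /\ Derive (H j) (a + t) = H (S j) (a + t)).
  { intros j t Hj Ht. assert (D := HD j (a + t) Hj ltac:(lra)).
    split; [eexists; exact D | now apply is_derive_unique]. }
  assert (B2 : forall t, 0 <= t <= 1 -> Rabs (phi2 t) <= B).
  { apply bound_from_derivative with phi3; auto.
    - unfold phi2. rewrite Rplus_0_r. field.
    - intros t Ht. unfold phi2, phi3.
      destruct (X 2%nat t ltac:(lia) Ht) as [X2 E2].
      destruct (X 3%nat t ltac:(lia) Ht) as [X3 E3].
      destruct (X 4%nat t ltac:(lia) Ht) as [X4 E4].
      auto_derive; [now repeat split |]. change (Derive (fun x => H 2%nat x) (a + t)) with (Derive (H 2%nat) (a + t)). change (Derive (fun x => H 3%nat x) (a + t)) with (Derive (H 3%nat) (a + t)). change (Derive (fun x => H 4%nat x) (a + t)) with (Derive (H 4%nat) (a + t)). rewrite E2, E3, E4. field. }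
  assert (B1 : forall t, 0 <= t <= 1 -> Rabs (phi1 t) <= B).
  { apply bound_from_derivative with phi2; auto.
    - unfold phi1. rewrite Rplus_0_r. field.
    - intros t Ht. unfold phi1, phi2.
      destruct (X 1%nat t ltac:(lia) Ht) as [X1 E1].
      destruct (X 2%nat t ltac:(lia) Ht) as [X2 E2].
      destruct (X 3%nat t ltac:(lia) Ht) as [X3 E3].
      auto_derive; [now repeat split |]. change (Derive (fun x => H 1%nat x) (a + t)) with (Derive (H 1%nat) (a + t)). change (Derive (fun x => H 2%nat x) (a + t)) with (Derive (H 2%nat) (a + t)). change (Derive (fun x => H 3%nat x) (a + t)) with (Derive (H 3%nat) (a + t)). rewrite E1, E2, E3. field. }
  assert (B0 : forall t, 0 <= t <= 1 -> Rabs (phi0 t) <= B).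
  { apply bound_from_derivative with phi1; auto.
    - unfold phi0. rewrite Rplus_0_r. field.
    - intros t Ht. unfold phi0, phi1.
      destruct (X 0%nat t ltac:(lia) Ht) as [X0 E0].
      destruct (X 1%nat t ltac:(lia) Ht) as [X1 E1].
      destruct (X 2%nat t ltac:(lia) Ht) as [X2 E2].
      auto_derive; [now repeat split |]. change (Derive (fun x => H 0%nat x) (a + t)) with (Derive (H 0%nat) (a + t)). change (Derive (fun x => H 1%nat x) (a + t)) with (Derive (H 1%nat) (a + t)). change (Derive (fun x => H 2%nat x) (a + t)) with (Derive (H 2%nat) (a + t)). rewrite E0, E1, E2. field. }
  specialize (B0 1 ltac:(lra)). unfold phi0 in B0.
  match goal with |- Rabs ?x <= _ => match type of B0 with Rabs ?y <= _ =>
    replace x with y by field end end. exact B0.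
Qed.

(** The coefficient of w^m in (2+w)(3+w)...(1+j+w) y^(2+j) exp (L w).  For
    y = -1/x and L = - ln x this is the m-th Taylor coefficient at s = 3, in w = s - 3,
    of the j-th derivative in x of x^(1-s).  Keeping y and L free lets the same
    expression, taken at |y| and |L|, serve as its own majorant. *)
Fixpoint pow_coef (j : nat) (y L : R) (m : nat) : R :=
  match j with
  | O => y ^ 2 * (L ^ m / INR (fact m))
  | S j' => y * (INR (2 + j') * pow_coef j' y L m
                 + match m with O => 0 | S m' => pow_coef j' y L m' end)
  end.

(** The sum over m of pow_coef j y L m * w^m in closed form. *)
Fixpoint pow_val (j : nat) (y L w : R) : R :=
  match j with
  | O => y ^ 2 * exp (L * w)
  | S j' => y * ((INR (2 + j') + w) * pow_val j' y L w)
  end.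

Lemma pow_coef_derive (j m : nat) (x : R) : 0 < x ->
  is_derive (fun x => pow_coef j (- / x) (- ln x) m) x
    (pow_coef (S j) (- / x) (- ln x) m).
Proof.
  intros Hx. revert m. induction j as [|j IH]; intros m.
  - simpl pow_coef. destruct m as [|m].
    + simpl. auto_derive; [repeat split; lra |]. field. lra.
    + change (fact (S m)) with (S m * fact m)%nat. rewrite mult_INR.
      assert (Hf := INR_fact_neq_0 m). assert (Hs := not_0_INR (S m) ltac:(lia)).
      auto_derive; [repeat split; lra |].
      change (pred (S m)) with m. replace (INR (1 + 1)) with 2 by (simpl; ring).
      rewrite <- !tech_pow_Rmult.
      change (match m with O => 1 | S _ => INR m + 1 end) with (INR (S m)).
      field. repeat split; auto; lra.
  - set (K := INR (2 + j)).
    set (f := fun x : R => pow_coef j (- / x) (- ln x) m).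
    set (g := fun x : R => match m with O => 0 | S m' => pow_coef j (- / x) (- ln x) m' end).
    assert (D1 : is_derive f x (pow_coef (S j) (- / x) (- ln x) m)) by apply IH.
    set (G := match m with O => 0 | S m' => pow_coef (S j) (- / x) (- ln x) m' end).
    assert (D2 : is_derive g x G).
    { unfold g, G. destruct m as [|m]; [apply (is_derive_const (V := R_NormedModule)) | apply IH]. }
    apply is_derive_ext with (fun x => - / x * (K * f x + g x)); [reflexivity |].
    auto_derive.
    + assert (ex_derive f x) by (eexists; exact D1).
      assert (ex_derive g x) by (eexists; exact D2).
      split; [lra | auto].
    + change (Derive (fun x => f x) x) with (Derive f x).
      change (Derive (fun x => g x) x) with (Derive g x).
      rewrite (is_derive_unique _ _ _ D1), (is_derive_unique _ _ _ D2).
      change (pow_coef (S (S j)) (- / x) (- ln x) m) with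
        (- / x * (INR (2 + S j) * pow_coef (S j) (- / x) (- ln x) m
          + G)).
      replace (INR (2 + S j)) with (K + 1) by (unfold K; change (2 + S j)%nat with (S (2 + j)); now rewrite S_INR).
      change (pow_coef (S j) (- / x) (- ln x) m) with (- / x * (K * f x + g x)).
      field. lra.
Qed.

Lemma pow_coef_val (j : nat) (y L w : R) :
  is_pseries (pow_coef j y L) w (pow_val j y L w).
Proof.
  induction j as [|j IH].
  - simpl. apply is_pseries_R.
    apply is_series_ext with (fun m => scal (y ^ 2) (scal (pow_n (L * w) m) (/ INR (fact m)))).
    + intros m.
      change (y ^ 2 * ((L * w) ^ m * / INR (fact m)) = y ^ 2 * (L ^ m / INR (fact m)) * w ^ m).
      rewrite Rpow_mult_distr. unfold Rdiv. ring.
    + apply (is_series_scal (V := R_NormedModule)). apply is_exp_Reals.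
  - apply is_pseries_ext with
      (PS_scal (V := R_NormedModule) y
        (PS_plus (PS_scal (INR (2 + j)) (pow_coef j y L)) (PS_incr_1 (pow_coef j y L)))).
    { intros [|m]; reflexivity. }
    replace (pow_val (S j) y L w) with
      (scal y (plus (scal (INR (2 + j)) (pow_val j y L w)) (scal w (pow_val j y L w)))).
    + apply (is_pseries_scal (V := R_NormedModule)); [apply Rmult_comm |].
      apply (is_pseries_plus (V := R_NormedModule)).
      * apply (is_pseries_scal (V := R_NormedModule)); [apply Rmult_comm | exact IH].
      * apply (is_pseries_incr_1 (V := R_NormedModule)). exact IH.
    + cbn [pow_val]. unfold scal, plus; simpl. unfold mult; simpl. ring.
Qed.

(** The coefficients are polynomials in y and L with nonnegative coefficients. *)
Lemma pow_coef_mono (j m : nat) (y y' L L' : R) :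
  Rabs y <= y' -> Rabs L <= L' -> Rabs (pow_coef j y L m) <= pow_coef j y' L' m.
Proof.
  intros Hy HL. revert m. induction j as [|j IH]; intros m.
  - cbn [pow_coef]. unfold Rdiv. rewrite !Rabs_mult.
    assert (P := Rinv_0_lt_compat _ (INR_fact_lt_0 m)).
    rewrite (Rabs_pos_eq (/ _)) by lra.
    apply Rmult_le_compat; try apply Rabs_pos.
    + apply Rmult_le_pos; [apply Rabs_pos | lra].
    + rewrite <- RPow_abs. apply pow_incr. split; [apply Rabs_pos | auto].
    + apply Rmult_le_compat_r; [lra |].
      rewrite <- RPow_abs. apply pow_incr. split; [apply Rabs_pos | auto].
  - cbn [pow_coef]. rewrite Rabs_mult.
    apply Rmult_le_compat; auto; try apply Rabs_pos.
    eapply Rle_trans; [apply Rabs_triang |].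
    apply Rplus_le_compat.
    + rewrite Rabs_mult, (Rabs_pos_eq (INR _)) by apply pos_INR.
      apply Rmult_le_compat_l; [apply pos_INR | apply IH].
    + destruct m; [rewrite Rabs_R0; lra | apply IH].
Qed.

Lemma pow_coef_abs_sum (j M : nat) (y L w : R) :
  0 <= y -> 0 <= L -> 0 <= w ->
  sum_n (fun m => pow_coef j y L m * w ^ m) M <= pow_val j y L w.
Proof.
  intros Hy HL Hw.
  assert (H := pow_coef_val j y L w). apply is_pseries_R in H.
  rewrite <- (is_series_unique _ _ H).
  assert (P : forall m, 0 <= pow_coef j y L m * w ^ m).
  { intros m. apply Rmult_le_pos; [| now apply pow_le].
    apply Rle_trans with (1 := Rabs_pos (pow_coef j y L m)), pow_coef_mono;
    rewrite Rabs_pos_eq; auto; apply Rle_refl. }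
  eapply is_lim_seq_incr_compare.
  - exact (Series_correct _ (ex_intro _ _ H)).
  - intros n. rewrite sum_Sn. unfold plus; simpl. generalize (P (S n)); simpl; lra.
Qed.

(** * A power series for (s - 1) zeta(s) *)

Lemma ex_series_inv_sqr : ex_series (fun n => / INR (S n) ^ 2).
Proof.
  apply ex_series_dominated with (fun n => 2 * (/ INR (S n) - / INR (S (S n)))).
  - intros n. assert (H := pos_INR n). rewrite !S_INR.
    split.
    + left. apply Rinv_0_lt_compat. apply pow_lt. lra.
    + replace (2 * (/ (INR n + 1) - / (INR n + 1 + 1))) with
        (/ ((INR n + 1) * (INR n + 1 + 1) / 2)) by (field; lra).
      apply Rinv_le_contravar; nra.
  - apply (ex_series_scal_l 2 (fun n => / INR (S n) - / INR (S (S n)))).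
    exists (1 - 0).
    assert (L : is_lim_seq (fun n => 1 - / INR (S (S n))) (1 - 0)).
    { apply is_lim_seq_minus'; [apply is_lim_seq_const |].
      apply (is_lim_seq_inv _ p_infty); [| easy].
      apply is_lim_seq_ext with (fun n => INR (n + 2)); [intros n; f_equal; lia |].
      apply is_lim_seq_incr_n, is_lim_seq_INR. }
    refine (is_lim_seq_ext _ _ _ _ L).
    intros n. induction n as [|n IH].
    + rewrite sum_O. simpl. field.
    + rewrite sum_Sn, <- IH. unfold plus; simpl AbelianMonoid.plus.
      change (1 - / INR (S (S (S n))) =
        1 - / INR (S (S n)) + (/ INR (S (S n)) - / INR (S (S (S n))))). ring.
Qed.

(** The Euler--Maclaurin boundary term H - H'/2 + H''/12 at x of H = x^(1-s), as Taylor
    coefficients in w = s - 3. *)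
Definition em_coef (x : R) (m : nat) : R :=
  pow_coef 0 (- / x) (- ln x) m - pow_coef 1 (- / x) (- ln x) m / 2
  + pow_coef 2 (- / x) (- ln x) m / 12.

(** The function of w whose Taylor coefficients are em_coef x. *)
Definition em_val (x w : R) : R :=
  pow_val 0 (- / x) (- ln x) w - pow_val 1 (- / x) (- ln x) w / 2
  + pow_val 2 (- / x) (- ln x) w / 12.

(** Summing over n telescopes the boundary terms and leaves the terms
    - H'(k+1) = (s-1) (k+1)^(-s), so the sum of the rows is (s - 1) zeta(s).  Row 0 is
    the boundary term at 1; row k+1 is the Euler--Maclaurin error on [k+1, k+2]. *)
Definition zeta_coef (n m : nat) : R :=
  match n with
  | O => em_coef 1 m
  | S k => em_coef (INR (S (S k))) m - em_coef (INR (S k)) m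
           - pow_coef 1 (- / INR (S k)) (- ln (INR (S k))) m
  end.

Definition zeta_val (n : nat) (w : R) : R :=
  match n with
  | O => em_val 1 w
  | S k => em_val (INR (S (S k))) w - em_val (INR (S k)) w
           - pow_val 1 (- / INR (S k)) (- ln (INR (S k))) w
  end.

(** A bound for the sum over m of |zeta_coef n m| 5^m.  Five derivatives at w = 5 give
    7*8*9*10*11 (k+2)^5 / (k+1)^7, and (k+2)^5 <= 32 (k+1)^5; the constant is a round
    number above 7*8*9*10*11*32. *)
Definition zeta_bound (n : nat) : R :=
  match n with
  | O => pow_val 0 1 0 5 + pow_val 1 1 0 5 + pow_val 2 1 0 5
  | S k => 2000000 * / INR (S k) ^ 2
  end.

Lemma em_coef_val (x w : R) : is_pseries (em_coef x) w (em_val x w).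
Proof.
  apply is_pseries_ext with
    (PS_plus (V := R_NormedModule) 
      (PS_plus (pow_coef 0 (- / x) (- ln x)) (PS_scal (- / 2) (pow_coef 1 (- / x) (- ln x))))
      (PS_scal (/ 12) (pow_coef 2 (- / x) (- ln x)))).
  { intros m. unfold em_coef, PS_plus, PS_scal, plus, scal. 
    change (pow_coef 0 (- / x) (- ln x) m + - / 2 * pow_coef 1 (- / x) (- ln x) m
      + / 12 * pow_coef 2 (- / x) (- ln x) m =
      pow_coef 0 (- / x) (- ln x) m - pow_coef 1 (- / x) (- ln x) m / 2
  + pow_coef 2 (- / x) (- ln x) m / 12). field. }
  replace (em_val x w) with
    (plus (plus (pow_val 0 (- / x) (- ln x) w) (scal (- / 2) (pow_val 1 (- / x) (- ln x) w)))
      (scal (/ 12) (pow_val 2 (- / x) (- ln x) w))).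
  - apply (is_pseries_plus (V := R_NormedModule)); [apply (is_pseries_plus (V := R_NormedModule)) |];
    [apply pow_coef_val | |];
    (apply (is_pseries_scal (V := R_NormedModule)); [apply Rmult_comm | apply pow_coef_val]).
  - unfold em_val, plus, scal.
    change (pow_val 0 (- / x) (- ln x) w + - / 2 * pow_val 1 (- / x) (- ln x) w
      + / 12 * pow_val 2 (- / x) (- ln x) w =
      pow_val 0 (- / x) (- ln x) w - pow_val 1 (- / x) (- ln x) w / 2
  + pow_val 2 (- / x) (- ln x) w / 12). field.
Qed.

Lemma zeta_coef_val (n : nat) (w : R) : is_pseries (zeta_coef n) w (zeta_val n w).
Proof.
  destruct n as [|k]; [apply em_coef_val |].
  apply (is_pseries_minus (V := R_NormedModule)
    (PS_minus (em_coef (INR (S (S k)))) (em_coef (INR (S k))))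
    (pow_coef 1 (- / INR (S k)) (- ln (INR (S k)))) w
    (em_val (INR (S (S k))) w - em_val (INR (S k)) w)).
  - apply (is_pseries_minus (V := R_NormedModule)); apply em_coef_val.
  - apply pow_coef_val.
Qed.

(** On [a, a+1] the fifth derivative is largest in absolute value when 1/x is taken at
    the left end and ln x at the right end. *)
Lemma zeta_coef_bound (k m : nat) :
  Rabs (zeta_coef (S k) m) <= pow_coef 5 (/ INR (S k)) (ln (INR (S (S k)))) m.
Proof.
  assert (Hk : 1 <= INR (S k)) by (rewrite S_INR; generalize (pos_INR k); lra).
  unfold zeta_coef. rewrite (S_INR (S k)). set (a := INR (S k)) in *.
  set (H := fun j x => pow_coef j (- / x) (- ln x) m).
  assert (E := euler_maclaurin_step H a (pow_coef 5 (/ a) (ln (a + 1)) m)).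
  eapply Rle_trans; [| apply E].
  - right. f_equal. unfold em_coef, H. field.
  - intros j x _ Hx. apply pow_coef_derive. lra.
  - intros x Hx. apply pow_coef_mono.
    + rewrite Rabs_Ropp, Rabs_pos_eq; [apply Rinv_le_contravar; lra |].
      left. apply Rinv_0_lt_compat. lra.
    + rewrite Rabs_Ropp, Rabs_pos_eq; [apply ln_le; lra |].
      rewrite <- ln_1. apply ln_le; lra.
Qed.

Lemma exp_INR_mult (n : nat) (x : R) : exp (INR n * x) = exp x ^ n.
Proof.
  induction n as [|n IH]; [simpl; now rewrite Rmult_0_l, exp_0 |].
  rewrite S_INR, Rmult_plus_distr_r, Rmult_1_l, exp_plus, IH. simpl. ring.
Qed.

Lemma zeta_coef_abs_sum (n M : nat) :
  sum_n (fun m => Rabs (zeta_coef n m) * 5 ^ m) M <= zeta_bound n.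
Proof.
  destruct n as [|k].
  - apply Rle_trans with
      (plus (plus (sum_n (fun m => pow_coef 0 1 0 m * 5 ^ m) M)
       (sum_n (fun m => pow_coef 1 1 0 m * 5 ^ m) M))
       (sum_n (fun m => pow_coef 2 1 0 m * 5 ^ m) M)).
    + rewrite <- !(sum_n_plus (G := R_AbelianMonoid)). rewrite !sum_n_Reals. apply sum_Rle. intros m _.
      change (@plus R_AbelianMonoid) with Rplus.
      rewrite <- !Rmult_plus_distr_r. apply Rmult_le_compat_r; [apply pow_le; lra |].
      unfold zeta_coef, em_coef. rewrite ln_1, Ropp_0, Rinv_1.
      assert (B : forall j, Rabs (pow_coef j (- (1)) 0 m) <= pow_coef j 1 0 m).
      { intros j. apply pow_coef_mono; [rewrite Rabs_Ropp, Rabs_R1 | rewrite Rabs_R0]; apply Rle_refl. }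
      assert (B0 := B 0%nat). assert (B1 := B 1%nat). assert (B2 := B 2%nat).
      apply Rabs_le_between in B0, B1, B2.
      apply Rabs_le. lra.
    + unfold zeta_bound. change (@plus R_AbelianMonoid) with Rplus.
      repeat apply Rplus_le_compat; apply pow_coef_abs_sum; lra.
  - assert (Hk : 1 <= INR (S k)) by (rewrite S_INR; generalize (pos_INR k); lra).
    apply Rle_trans with (sum_n (fun m => pow_coef 5 (/ INR (S k)) (ln (INR (S (S k)))) m * 5 ^ m) M).
    + rewrite !sum_n_Reals. apply sum_Rle. intros m _.
      apply Rmult_le_compat_r; [apply pow_le; lra | apply zeta_coef_bound].
    + eapply Rle_trans; [apply pow_coef_abs_sum |].
      * left. apply Rinv_0_lt_compat. lra.
      * rewrite <- ln_1. apply ln_le; rewrite ?(S_INR (S k)); lra.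
      * lra.
      * unfold zeta_bound. cbn [pow_val].
        rewrite (Rmult_comm _ 5). replace 5 with (INR 5) at 6 by (simpl; ring).
        rewrite exp_INR_mult, exp_ln by (rewrite S_INR; lra).
        rewrite (S_INR (S k)). set (a := INR (S k)) in *.
        simpl INR.
        apply Rle_trans with (55440 * (/ a ^ 7 * (a + 1) ^ 5)).
        { right. field. lra. }
        apply Rle_trans with (55440 * (/ a ^ 7 * (2 * a) ^ 5)).
        { apply Rmult_le_compat_l; [lra |]. apply Rmult_le_compat_l.
          - left. apply Rinv_0_lt_compat. apply pow_lt. lra.
          - apply pow_incr. lra. }
        replace (/ a ^ 7 * (2 * a) ^ 5) with (32 * / a ^ 2) by (field; lra).
        assert (0 < / a ^ 2) by (apply Rinv_0_lt_compat, pow_lt; lra). lra.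
Qed.

Lemma ex_series_zeta_bound : ex_series zeta_bound.
Proof.
  apply ex_series_incr_1. apply (ex_series_scal_l 2000000 (fun k => / INR (S k) ^ 2)), ex_series_inv_sqr.
Qed.

(** The Taylor coefficients at s = 3 of (s - 1) zeta(s). *)
Definition cont_coef (m : nat) : R := Series (fun n => zeta_coef n m).

(** Interchanges the sums over n and m against any weights q with |q m| <= 5^m: the
    weights w^m give the value of the series, and m w^(m-1) its derivative. *)
Lemma cont_coef_swap (q r : nat -> R) :
  (forall m, Rabs (q m) <= 5 ^ m) ->
  (forall n, is_series (fun m => zeta_coef n m * q m) (r n)) ->
  is_series (fun m => cont_coef m * q m) (Series r) /\ ex_series r.
Proof.
  intros Hq Hr.
  assert (Hb : forall n M, sum_n (fun m => Rabs (zeta_coef n m * q m)) M <= zeta_bound n).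
  { intros n M. eapply Rle_trans; [| apply (zeta_coef_abs_sum n M)].
    rewrite !sum_n_Reals. apply sum_Rle. intros m _. rewrite Rabs_mult.
    apply Rmult_le_compat_l; [apply Rabs_pos | apply Hq]. }
  destruct (series_swap (fun n m => zeta_coef n m * q m) r zeta_bound Hb
    ex_series_zeta_bound Hr) as [_ H].
  split.
  - eapply is_series_ext; [| exact H]. intros m. apply Series_scal_r.
  - apply (ex_series_le r zeta_bound); [| apply ex_series_zeta_bound].
    intros n. change (Rabs (r n) <= zeta_bound n).
    assert (A : is_lim_seq (fun M => Rabs (sum_n (fun m => zeta_coef n m * q m) M)) (Rabs (r n))).
    { apply (is_lim_seq_abs _ (r n)). exact (Hr n). }
    refine (is_lim_seq_le _ (fun _ => zeta_bound n) _ (Finite _) _ A (is_lim_seq_const _)).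
    intros M. eapply Rle_trans; [| apply (Hb n M)].
    rewrite !sum_n_Reals. apply Rsum_abs.
Qed.

Lemma zeta_coef_row_summable (n : nat) : ex_series (fun m => Rabs (zeta_coef n m) * 5 ^ m).
Proof.
  assert (H : ex_finite_lim_seq (sum_n (fun m => Rabs (zeta_coef n m) * 5 ^ m))).
  { apply ex_finite_lim_seq_incr with (zeta_bound n).
    - intros M. rewrite sum_Sn. change plus with Rplus.
      assert (P : 0 <= Rabs (zeta_coef n (S M)) * 5 ^ S M)
        by (apply Rmult_le_pos; [apply Rabs_pos | apply pow_le; lra]).
      revert P. generalize (Rabs (zeta_coef n (S M)) * 5 ^ S M). intros y Hy. lra.
    - intros M. apply zeta_coef_abs_sum. }
  exact H.
Qed.

Lemma cont_coef_abs : ex_series (fun m => Rabs (cont_coef m) * 5 ^ m).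
Proof.
  set (u := fun n m => Rabs (zeta_coef n m) * 5 ^ m).
  assert (Hp : forall n m, 0 <= u n m).
  { intros n m. apply Rmult_le_pos; [apply Rabs_pos | apply pow_le; lra]. }
  assert (Hb : forall n M, sum_n (fun m => Rabs (u n m)) M <= zeta_bound n).
  { intros n M. eapply Rle_trans; [| apply (zeta_coef_abs_sum n M)].
    right. apply sum_n_ext. intros m. apply Rabs_pos_eq, Hp. }
  destruct (series_swap u (fun n => Series (u n)) zeta_bound Hb ex_series_zeta_bound
    (fun n => Series_correct _ (zeta_coef_row_summable n))) as [Hc H].
  apply ex_series_dominated with (fun m => Series (fun n => u n m)).
  - intros m. split; [apply Rmult_le_pos; [apply Rabs_pos | apply pow_le; lra] |].
    assert (Hc' : ex_series (fun n => Rabs (zeta_coef n m))).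
    { apply ex_series_ext with (fun n => u n m * / 5 ^ m).
      - intros n. change (Rabs (zeta_coef n m) * 5 ^ m * / 5 ^ m = Rabs (zeta_coef n m)).
        field. apply pow_nonzero. lra.
      - apply (ex_series_scal_r (/ 5 ^ m)). apply Hc. }
    unfold u. rewrite Series_scal_r. apply Rmult_le_compat_r; [apply pow_le; lra |].
    unfold cont_coef. now apply Series_Rabs.
  - eexists. exact H.
Qed.

Lemma cont_pseries (w : R) : Rabs w <= 5 ->
  is_pseries cont_coef w (Series (fun n => zeta_val n w)) /\
  ex_series (fun n => zeta_val n w).
Proof.
  intros Hw.
  destruct (cont_coef_swap (fun m => w ^ m) (fun n => zeta_val n w)) as [H1 H2].
  - intros m. rewrite <- RPow_abs. apply pow_incr. split; [apply Rabs_pos | auto].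
  - intros n. apply is_pseries_R, zeta_coef_val.
  - split; auto. now apply is_pseries_R.
Qed.

Lemma CV_radius_of_abs (a : nat -> R) (r : R) : 0 <= r ->
  ex_series (fun m => Rabs (a m) * r ^ m) -> Rbar_le r (CV_radius a).
Proof.
  intros Hr H. apply (proj1 (CV_radius_bounded a)).
  assert (L := ex_series_lim_0 _ H).
  destruct (filterlim_bounded (V := R_NormedModule) (fun m => Rabs (a m) * r ^ m)) as [M HM].
  { exists 0. exact L. }
  exists M. intros n. rewrite Rabs_mult, (Rabs_pos_eq (r ^ n)) by now apply pow_le.
  eapply Rle_trans; [| apply HM]. apply Rle_abs.
Qed.

Lemma zeta_coef_radius (n : nat) : Rbar_le 5 (CV_radius (zeta_coef n)).
Proof.
  apply CV_radius_of_abs; [lra | apply zeta_coef_row_summable].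
Qed.

(** Term-by-term differentiation in n.  The weights m w^(m-1) with |w| <= 4 are below
    5^m, as m 4^(m-1) is one term of the binomial expansion of (4 + 1)^m. *)
Lemma cont_pseries_derive (w : R) : Rabs w <= 4 ->
  is_derive (PSeries cont_coef) w (Series (fun n => Derive (zeta_val n) w)) /\
  ex_series (fun n => Derive (zeta_val n) w).
Proof.
  intros Hw.
  assert (Hq : forall m, Rabs (INR m * w ^ (m - 1)) <= 5 ^ m).
  { intros m. rewrite Rabs_mult, (Rabs_pos_eq (INR m)) by apply pos_INR.
    apply Rle_trans with (INR m * 4 ^ (m - 1)).
    - apply Rmult_le_compat_l; [apply pos_INR |].
      rewrite <- RPow_abs. apply pow_incr. split; [apply Rabs_pos | auto].
    - assert (P4 : forall m, 4 ^ m <= 5 ^ m) by (intros; apply pow_incr; lra).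
      induction m as [|m IH]; [simpl; lra |].
      rewrite S_INR. replace (S m - 1)%nat with m by lia.
      destruct m as [|m]; [simpl; lra |].
      replace (S m - 1)%nat with m in IH by lia.
      assert (T := P4 (S m)). cbn [pow] in *. lra. }
  assert (Hin : forall a : nat -> R, Rbar_le 5 (CV_radius a) -> Rbar_lt (Rabs w) (CV_radius a)).
  { intros a Ha. eapply Rbar_lt_le_trans; [| exact Ha]. simpl. lra. }
  assert (Hrow : forall a : nat -> R, Rbar_lt (Rabs w) (CV_radius a) -> 
    is_series (fun m => a m * (INR m * w ^ (m - 1))) (Derive (PSeries a) w)).
  { intros a Ha. assert (D := is_pseries_derive a w Ha).
    apply is_pseries_R in D. apply is_series_decr_1.
    replace (plus _ _) with (Derive (PSeries a) w).
    - refine (is_series_ext _ _ _ _ D). intros m. unfold PS_derive.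
      replace (S m - 1)%nat with m by lia.
      change (INR (S m) * a (S m) * w ^ m = a (S m) * (INR (S m) * w ^ m)). ring.
    - change (Derive (PSeries a) w = Derive (PSeries a) w + - (a O * (INR 0 * w ^ (0 - 1)))).
      simpl. ring. }
  assert (Hc : Rbar_lt (Rabs w) (CV_radius cont_coef)).
  { apply Hin, CV_radius_of_abs; [lra | apply cont_coef_abs]. }
  destruct (cont_coef_swap (fun m => INR m * w ^ (m - 1)) (fun n => Derive (zeta_val n) w) Hq)
    as [H1 H2].
  { intros n. assert (Hz := Hin _ (zeta_coef_radius n)).
    rewrite (Derive_ext (zeta_val n) (PSeries (zeta_coef n))).
    - now apply Hrow.
    - intros t. symmetry. apply is_pseries_unique, zeta_coef_val. }
  split; auto.
  replace (Series (fun n => Derive (zeta_val n) w)) with (Derive (PSeries cont_coef) w).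
  - apply Derive_correct. eexists. now apply is_derive_PSeries.
  - rewrite <- (is_series_unique _ _ H1). symmetry. apply is_series_unique.
    now apply Hrow.
Qed.

Lemma zeta_val_sum (N : nat) (w : R) :
  sum_n (fun n => zeta_val n w) N =
  em_val (INR (S N)) w
  - sum_n (fun n => match n with O => 0 | S k => pow_val 1 (- / INR (S k)) (- ln (INR (S k))) w end) N.
Proof.
  induction N as [|N IH].
  - rewrite !sum_O. unfold zeta_val. simpl INR.
    match goal with |- @eq _ ?a ?b => change (@eq R a b) end. ring.
  - rewrite !sum_Sn, IH. change plus with Rplus. unfold zeta_val.
    match goal with |- @eq _ ?a ?b => change (@eq R a b) end. ring.
Qed.

(** * The derivative of zeta at -1 *)

Lemma em_val_eq (x w : R) : 0 < x ->
  em_val x w = exp (- ln x * w) * / x ^ 2 *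
    (1 + (2 + w) / (2 * x) + (2 + w) * (3 + w) / (12 * x ^ 2)).
Proof. intros Hx. unfold em_val. cbn [pow_val]. simpl INR. field. lra. Qed.

Lemma exp_neg_ln_mult (x : R) (n : nat) : 0 < x -> exp (- ln x * - INR n) = x ^ n.
Proof.
  intros Hx. replace (- ln x * - INR n) with (INR n * ln x) by ring.
  now rewrite exp_INR_mult, exp_ln.
Qed.

(** The boundary term at infinity vanishes where the Dirichlet series converges, so
    that the rows sum to (s - 1) zeta(s). *)
Lemma em_val_lim (w : R) : Rabs w < 1 -> is_lim_seq (fun N => em_val (INR (S N)) w) 0.
Proof.
  intros Hw. apply Rabs_def2 in Hw.
  apply is_lim_seq_le_le with (fun _ => 0) (fun N => 5 * / INR (S N)).
  - intros N. assert (HN : 1 <= INR (S N)) by (rewrite S_INR; generalize (pos_INR N); lra).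
    set (x := INR (S N)) in *. rewrite em_val_eq by lra.
    assert (Ix : 0 < / x <= 1).
    { split; [apply Rinv_0_lt_compat; lra |]. rewrite <- Rinv_1. apply Rinv_le_contravar; lra. }
    assert (E : exp (- ln x * w) <= x).
    { rewrite <- (exp_ln x) at 2 by lra.
      assert (0 <= ln x) by (rewrite <- ln_1; apply ln_le; lra).
      destruct (Req_dec (- ln x * w) (ln x)) as [-> | Hne]; [lra |].
      left. apply exp_increasing. nra. }
    assert (E0 := exp_pos (- ln x * w)).
    assert (T : 1 <= 1 + (2 + w) / (2 * x) + (2 + w) * (3 + w) / (12 * x ^ 2) <= 5).
    { replace ((2 + w) / (2 * x)) with ((2 + w) / 2 * / x) by (field; lra).
      replace ((2 + w) * (3 + w) / (12 * x ^ 2)) with ((2 + w) * (3 + w) / 12 * (/ x * / x)) by (field; lra).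
      assert (0 < / x * / x <= 1) by nra.
      assert (0 <= (2 + w) * (3 + w) / 12 <= 1) by nra.
      nra. }
    assert (P2 : 0 < / x ^ 2) by (apply Rinv_0_lt_compat, pow_lt; lra).
    split.
    + apply Rmult_le_pos; [apply Rmult_le_pos |]; lra.
    + apply Rle_trans with (x * / x ^ 2 * 5).
      * apply Rmult_le_compat; try lra.
        -- apply Rmult_le_pos; lra.
        -- apply Rmult_le_compat_r; lra.
      * right. field. lra.
  - apply is_lim_seq_const.
  - replace (Finite 0) with (Rbar_mult 5 0) by (simpl; f_equal; ring).
    apply is_lim_seq_scal_l.
    apply (is_lim_seq_inv _ p_infty); [| easy].
    apply (is_lim_seq_incr_1 INR). apply is_lim_seq_INR.
Qed.

Lemma zeta_real (zeta : C -> C) (w : R) :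
  is_riemann_zeta zeta -> Rabs w < 1 ->
  (RtoC (2 + w) * zeta (RtoC (3 + w)))%C = RtoC (PSeries cont_coef w).
Proof.
  intros [Hz _] Hw.
  assert (Hd : forall n, dirichlet_term (RtoC (3 + w)) n =
    RtoC (exp (- ln (INR (S n)) * w) * / INR (S n) ^ 3)).
  { intros n. assert (Hn : 0 < INR (S n)) by (apply lt_0_INR; lia).
    unfold dirichlet_term, Cexp. 
    replace (- RtoC (3 + w) * RtoC (ln (INR (S n))))%C with (RtoC (- (3 + w) * ln (INR (S n))))
      by (rewrite RtoC_mult, RtoC_opp; reflexivity).
    unfold Re, Im, RtoC. cbn [fst snd]. rewrite cos_0, sin_0, Rmult_0_r, Rmult_1_r. f_equal.
    replace (- (3 + w) * ln (INR (S n))) with (- ln (INR (S n)) * w + - (INR 3 * ln (INR (S n))))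
      by (simpl; ring).
    now rewrite exp_plus, exp_Ropp, exp_INR_mult, exp_ln. }
  assert (Hs : @is_series C_AbsRing C_NormedModule (dirichlet_term (RtoC (3 + w))) (zeta (RtoC (3 + w)))).
  { apply Hz. simpl. apply Rabs_def2 in Hw. lra. }
  apply is_series_C in Hs. destruct Hs as [Hre Him].
  assert (HIm : Im (zeta (RtoC (3 + w))) = 0).
  { rewrite <- (is_series_unique _ _ Him).
    rewrite (Series_ext _ (fun _ => 0 * 0)).
    - rewrite Series_scal_l. ring.
    - intros n. rewrite Hd. simpl. ring. }
  assert (HRe : (2 + w) * Re (zeta (RtoC (3 + w))) = PSeries cont_coef w).
  { destruct (cont_pseries w) as [HP HS]; [lra |].
    rewrite (is_pseries_unique _ _ _ HP).
    assert (L1 := Series_correct _ HS).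
    assert (L2 : is_lim_seq (sum_n (fun n => zeta_val n w)) (0 + (2 + w) * Re (zeta (RtoC (3 + w))))).
    { apply is_lim_seq_incr_1.
      apply is_lim_seq_ext with (fun N => em_val (INR (S (S N))) w +
         (2 + w) * sum_n (fun n => Re (dirichlet_term (RtoC (3 + w)) n)) N).
      - intros N. rewrite zeta_val_sum. unfold Rminus. f_equal.
        induction N as [|N IH].
        + rewrite sum_Sn, !sum_O. change plus with Rplus. rewrite Hd. cbn [pow_val Re RtoC fst].
          simpl INR. field.
        + rewrite (sum_Sn _ (S N)), (sum_Sn _ N). change plus with Rplus.
          rewrite Ropp_plus_distr, <- IH. rewrite Rmult_plus_distr_l. f_equal.
          rewrite Hd. cbn [pow_val Re RtoC fst]. 
          assert (0 < INR (S (S N))) by (apply lt_0_INR; lia).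
          set (y := INR (S (S N))) in *. simpl INR. field. lra.
      - apply is_lim_seq_plus'.
        + apply (is_lim_seq_incr_1 (fun N => em_val (INR (S N)) w)). now apply em_val_lim.
        + apply (is_lim_seq_scal_l _ (2 + w) (Re (zeta (RtoC (3 + w))))). exact Hre. }
    rewrite Rplus_0_l in L2.
    assert (E1 := is_lim_seq_unique _ _ L2).
    assert (E2 : Lim_seq (sum_n (fun n => zeta_val n w)) = Series (fun n => zeta_val n w))
      by (apply is_lim_seq_unique; exact L1).
    rewrite E1 in E2. now injection E2. }
  rewrite <- HRe. destruct (zeta (RtoC (3 + w))) as [p q]. simpl in *. rewrite HIm.
  unfold RtoC, Cmult. simpl. f_equal; ring.
Qed.

(** The extension to the disc |s - 3| < 5 of the power series with coefficients
    cont_coef. *)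
Definition cont_fun (s : C) : C :=
  CSeries (fun m => (RtoC (cont_coef m) * (s - RtoC 3) ^ m)%C).

Lemma cont_fun_pseries (s : C) : Cmod (s - RtoC 3)%C < 5 ->
  @is_pseries C_AbsRing C_NormedModule (fun m => RtoC (cont_coef m)) (s - RtoC 3)%C (cont_fun s).
Proof.
  intros Hs. apply (proj2 (is_pseries_C (fun m => RtoC (cont_coef m)) _ _)).
  apply is_series_CSeries.
  apply ex_series_dominated with (fun m => Rabs (cont_coef m) * 5 ^ m); [| apply cont_coef_abs].
  intros m. split; [apply Cmod_ge_0 |]. rewrite Cmod_mult, Cmod_pow, Cmod_R.
  apply Rmult_le_compat_l; [apply Rabs_pos |]. apply pow_incr. split; [apply Cmod_ge_0 | lra].
Qed.

Lemma cont_fun_analytic (s : C) : Cmod (s - RtoC 3)%C < 5 -> analytic_at cont_fun s.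
Proof.
  apply analytic_at_recenter with (fun m => RtoC (cont_coef m)).
  - eapply ex_series_ext; [| apply cont_coef_abs]. intros m. simpl. now rewrite Cmod_R.
  - apply cont_fun_pseries.
Qed.

Lemma cont_fun_real (x : R) : Rabs (x - 3) < 5 -> cont_fun (RtoC x) = RtoC (PSeries cont_coef (x - 3)).
Proof.
  intros Hx. eapply is_series_C_eq.
  - apply (proj1 (is_pseries_C (fun m => RtoC (cont_coef m)) (RtoC x - RtoC 3)%C _)).
    apply cont_fun_pseries. rewrite <- RtoC_minus, Cmod_R. exact Hx.
  - apply is_series_C.
    assert (E : forall m, (RtoC (cont_coef m) * (RtoC x - RtoC 3) ^ m)%C =
      RtoC (cont_coef m * (x - 3) ^ m)).
    { intros m. now rewrite <- RtoC_minus, <- RtoC_pow, <- RtoC_mult. }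
    split.
    + apply is_series_ext with (fun m => cont_coef m * (x - 3) ^ m).
      * intros m. now rewrite E.
      * simpl. apply is_pseries_R. apply PSeries_correct.
        eexists. apply cont_pseries. lra.
    + apply is_series_ext with (fun m => 0 * cont_coef m).
      * intros m. rewrite E. simpl. ring.
      * change (is_lim_seq (sum_n (fun m => 0 * cont_coef m)) 0).
        apply is_lim_seq_ext with (fun _ => 0); [| apply is_lim_seq_const].
        intros n. rewrite (sum_n_mult_l (K := R_Ring)).
        change mult with Rmult. ring.
Qed.

Lemma analytic_at_mult_linear (f : C -> C) (b z0 : C) :
  analytic_at f z0 -> analytic_at (fun z => (z - b) * f z)%C z0.
Proof.
  intros [a [r [Hr Ha]]].
  exists (PS_plus (V := C_NormedModule) (PS_scal (z0 - b)%C a) (PS_incr_1 a)), r.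
  split; auto. intros z Hz.
  replace ((z - b) * f z)%C with
    (plus (@scal C_AbsRing C_NormedModule (z0 - b)%C (f z))
          (@scal C_AbsRing C_NormedModule (z - z0)%C (f z))).
  - apply (@is_pseries_plus C_AbsRing C_NormedModule).
    + apply (@is_pseries_scal C_AbsRing C_NormedModule); [apply Cmult_comm | now apply Ha].
    + apply (@is_pseries_incr_1 C_AbsRing C_NormedModule). now apply Ha.
  - change ((z0 - b) * f z + (z - z0) * f z = (z - b) * f z)%C. ring.
Qed.

Lemma Cmod_lt_of_sqr (a b r : R) : 0 < r -> a ^ 2 + b ^ 2 < r ^ 2 -> Cmod (a, b) < r.
Proof.
  intros Hr H. unfold Cmod. simpl fst; simpl snd.
  rewrite <- (sqrt_pow2 r) by lra. apply sqrt_lt_1_alt. split; [nra | lra].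
Qed.

(** The real points near 3 cluster at 3, which gives agreement near 3; the path
    3, 1 + 2i, -1 carries it to -1 inside the disc of radius 5 and away from 1. *)
Lemma zeta_continuation (zeta : C -> C) :
  is_riemann_zeta zeta ->
  agree_near (fun s => (s - RtoC 1) * zeta s)%C cont_fun (RtoC (-1)).
Proof.
  intros Hzeta. destruct (Hzeta) as [_ Han].
  set (f := fun s => ((s - RtoC 1) * zeta s)%C).
  assert (Hf : forall s, s <> RtoC 1 -> analytic_at f s).
  { intros s Hs. apply analytic_at_mult_linear. now apply Han. }
  assert (A3 : agree_near f cont_fun (RtoC 3)).
  { apply analytic_identity_local.
    - apply Hf. intros E. apply RtoC_inj in E. lra.
    - apply cont_fun_analytic. replace (RtoC 3 - RtoC 3)%C with (RtoC 0) by ring.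
      rewrite Cmod_0. lra.
    - intros d Hd. set (w := Rmin (d / 2) (1 / 2)).
      assert (Hw : 0 < w) by (apply Rmin_glb_lt; lra).
      assert (Hw1 : w <= d / 2) by apply Rmin_l.
      assert (Hw2 : w <= 1 / 2) by apply Rmin_r.
      exists (RtoC (3 + w)). split.
      + rewrite <- RtoC_minus, Cmod_R. replace (3 + w - 3) with w by ring.
        rewrite Rabs_pos_eq; lra.
      + unfold f. rewrite cont_fun_real.
        * rewrite <- RtoC_minus. replace (3 + w - 1) with (2 + w) by ring.
          rewrite zeta_real by (auto; rewrite Rabs_pos_eq; lra).
          replace (3 + w - 3) with w by ring. ring.
        * replace (3 + w - 3) with w by ring. rewrite Rabs_pos_eq; lra. }
  assert (Amid : agree_near f cont_fun (1, 2)).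
  { apply analytic_identity_segment with (RtoC 3); auto.
    - unfold RtoC. intros E. injection E. lra.
    - intros u Hu. 
      replace (RtoC 3 + RtoC u * ((1, 2) - RtoC 3))%C with ((3 - 2 * u)%R, (2 * u)%R) by
        (unfold RtoC, Cplus, Cmult, Cminus, Copp; simpl; unfold Cplus, Copp; simpl; f_equal; ring).
      split.
      + apply Hf. unfold RtoC. intros E. injection E. lra.
      + apply cont_fun_analytic. 
        replace (((3 - 2 * u)%R, (2 * u)%R) - RtoC 3)%C with ((- 2 * u)%R, (2 * u)%R) by
          (unfold RtoC, Cminus, Copp, Cplus; simpl; f_equal; ring).
        apply Cmod_lt_of_sqr; nra. }
  apply analytic_identity_segment with (1, 2); auto.
  - unfold RtoC. intros E. injection E. lra.
  - intros u Hu. 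
    replace ((1, 2) + RtoC u * (RtoC (-1) - (1, 2)))%C with ((1 - 2 * u)%R, (2 - 2 * u)%R) by
      (unfold RtoC, Cplus, Cmult, Cminus, Copp; simpl; unfold Cplus, Copp; simpl; f_equal; ring).
    split.
    + apply Hf. unfold RtoC. intros E. injection E. lra.
    + apply cont_fun_analytic. 
      replace (((1 - 2 * u)%R, (2 - 2 * u)%R) - RtoC 3)%C with ((- 2 - 2 * u)%R, (2 - 2 * u)%R) by
        (unfold RtoC, Cminus, Copp, Cplus; simpl; f_equal; ring).
      apply Cmod_lt_of_sqr; nra.
Qed.

(** Near -1 the real part of zeta(x) is P(x - 3) / (x - 1), P being the power series;
    the complex derivative is taken along the real axis, where the quotient rule applies. *)
Lemma zeta_derive_at_m1 (zeta : C -> C) :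
  is_riemann_zeta zeta ->
  Re (C_derive zeta (RtoC (-1))) =
    - Derive (PSeries cont_coef) (- 4) / 2 - PSeries cont_coef (- 4) / 4.
Proof.
  intros Hzeta.
  destruct (zeta_continuation zeta Hzeta) as [d [Hd Hag]].
  set (phi := fun x => PSeries cont_coef (x - 3) / (x - 1)).
  set (d' := Rmin d 1).
  assert (Hd' : 0 < d') by (apply Rmin_glb_lt; lra).
  assert (Hphi : forall x, Rabs (x + 1) < d' -> Re (zeta (RtoC x)) = phi x).
  { intros x Hx.
    assert (H1 : Rabs (x + 1) < 1) by (eapply Rlt_le_trans; [exact Hx | apply Rmin_r]).
    assert (H2 : Rabs (x + 1) < d) by (eapply Rlt_le_trans; [exact Hx | apply Rmin_l]).
    apply Rabs_def2 in H1.
    specialize (Hag (RtoC x)). cbv beta in Hag. rewrite cont_fun_real in Hag by (apply Rabs_def1; lra).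
    assert (Hc : Cmod (RtoC x - RtoC (-1)) < d).
    { rewrite <- RtoC_minus, Cmod_R. now replace (x - -1) with (x + 1) by ring. }
    specialize (Hag Hc). apply (f_equal Re) in Hag.
    destruct (zeta (RtoC x)) as [p q]. simpl in *. unfold phi. rewrite <- Hag. field. lra. }
  set (D := Derive (PSeries cont_coef) (- 4)).
  destruct (cont_pseries_derive (- 4)) as [HD _].
  { unfold Rabs; destruct Rcase_abs; lra. }
  assert (HD' : is_derive (PSeries cont_coef) (-1 - 3) D).
  { replace (-1 - 3) with (- 4) by ring. unfold D. rewrite (is_derive_unique _ _ _ HD). exact HD. }
  assert (Dphi : is_derive phi (-1) (- D / 2 - PSeries cont_coef (- 4) / 4)).
  { unfold phi. auto_derive.
    - split; [eexists; exact HD' | split; [lra | auto]].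
    - change (Derive (fun x => PSeries cont_coef x) (-1 + - (3))) with (Derive (PSeries cont_coef) (-1 + - (3))).
      replace (-1 + - (3)) with (-1 - 3) by ring.
      rewrite (is_derive_unique _ _ _ HD'). replace (-1 - 3) with (- 4) by ring.
      field. }
  apply is_derive_Reals in Dphi.
  unfold C_derive, C_lim. cbn [Re fst snd RtoC].
  apply (f_equal real (y := Finite (- D / 2 - PSeries cont_coef (- 4) / 4))).
  apply is_lim_unique. apply is_lim_spec. intros eps.
  destruct (Dphi eps (cond_pos eps)) as [del Hdel].
  assert (Hm : 0 < Rmin del d') by (apply Rmin_glb_lt; [apply cond_pos | auto]).
  exists (mkposreal _ Hm). change (forall y : R, Rabs (y - -1) < Rmin del d' -> y <> -1 ->
    Rabs (fst ((zeta (RtoC y) - zeta (-1, 0)) / (RtoC y - (-1, 0)))%C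
      - (- D / 2 - PSeries cont_coef (- 4) / 4)) < eps).
  intros y Hy Hne.
  set (h := y - -1) in *.
  assert (Hh : h <> 0) by (unfold h; lra).
  assert (Hy1 : Rabs h < del) by (eapply Rlt_le_trans; [exact Hy | apply Rmin_l]).
  assert (Hy2 : Rabs h < d') by (eapply Rlt_le_trans; [exact Hy | apply Rmin_r]).
  specialize (Hdel h Hh Hy1).
  replace (-1 + h) with y in Hdel by (unfold h; ring).
  assert (E1 : Re (zeta (RtoC y)) = phi y).
  { apply Hphi. now replace (y + 1) with h by (unfold h; ring). }
  assert (E2 : Re (zeta (RtoC (-1))) = phi (-1)).
  { apply Hphi. replace (-1 + 1) with 0 by ring. now rewrite Rabs_R0. }
  replace (RtoC y - (-1, 0))%C with (RtoC h) by (unfold h; now rewrite RtoC_minus).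
  replace (fst ((zeta (RtoC y) - zeta (-1, 0)) / RtoC h)%C) with ((phi y - phi (-1)) / h).
  - exact Hdel.
  - rewrite <- E1, <- E2. change (-1, 0) with (RtoC (-1)).
    destruct (zeta (RtoC y)) as [p q], (zeta (RtoC (-1))) as [p' q'].
    unfold Cdiv, Cinv, Cmult, Cminus, Cplus, Copp, RtoC; simpl. field. auto.
Qed.

(** * The sum of the j ln j and the Glaisher constant *)

Definition log_hyperfact (n : nat) : R := sum_n (fun j => INR j * ln (INR j)) n.

(** The partial sums do not depend on N, and (s - 1) zeta(s) is -2 * (-1/12) at -1. *)
Lemma cont_value : PSeries cont_coef (- 4) = / 6.
Proof.
  destruct (cont_pseries (- 4)) as [HP HS]; [unfold Rabs; destruct Rcase_abs; lra |].
  rewrite (is_pseries_unique _ _ _ HP). apply is_series_unique.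
  change (is_lim_seq (sum_n (fun n => zeta_val n (- 4))) (/ 6)).
  apply is_lim_seq_ext with (fun _ => / 6); [| apply is_lim_seq_const].
  intros N. rewrite zeta_val_sum.
  assert (E : forall x, 0 < x -> exp (- ln x * -4) = x ^ 4).
  { intros x Hx. rewrite <- (exp_neg_ln_mult x 4) by auto. f_equal. simpl. ring. }
  assert (S1 : sum_n (fun n => match n with O => 0 | S k => pow_val 1 (- / INR (S k)) (- ln (INR (S k))) (- 4) end) N
    = INR N * (INR N + 1)).
  { induction N as [|N IH].
    - rewrite sum_O. change (0 = 0 * (0 + 1)). ring.
    - rewrite sum_Sn, IH. change plus with Rplus. cbn [pow_val].
      assert (0 < INR (S N)) by (apply lt_0_INR; lia).
      rewrite E by auto. rewrite S_INR in *. simpl INR.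
      match goal with |- @eq _ ?a ?b => change (@eq R a b) end. field. lra. }
  rewrite S1.
  assert (0 < INR (S N)) by (apply lt_0_INR; lia).
  rewrite em_val_eq, E by auto. rewrite S_INR in *. field. lra.
Qed.

Lemma cont_derive_sum (N : nat) :
  sum_n (fun n => Derive (zeta_val n) (- 4)) N =
  (let x := INR (S N) in - ln x * (x ^ 2 - x + / 6) + x / 2 - / 4)
  + INR N * (INR N + 1) / 2 + 2 * log_hyperfact N.
Proof.
  assert (E : forall x, 0 < x -> exp (- ln x * -4) = x ^ 4).
  { intros x Hx. rewrite <- (exp_neg_ln_mult x 4) by auto. f_equal. simpl. ring. }
  assert (D1 : forall x, 0 < x -> is_derive (em_val x) (- 4)
    (- ln x * (x ^ 2 - x + / 6) + x / 2 - / 4)).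
  { intros x Hx. unfold em_val. cbn [pow_val]. simpl INR. auto_derive; auto.
    rewrite E by auto. field. lra. }
  assert (D2 : forall x, 0 < x -> is_derive (pow_val 1 (- / x) (- ln x)) (- 4)
    (- x * (1 + 2 * ln x))).
  { intros x Hx. cbn [pow_val]. simpl INR. auto_derive; auto.
    rewrite E by auto. field. lra. }
  unfold log_hyperfact. cbv zeta. induction N as [|N IH].
  - rewrite !sum_O. unfold zeta_val. simpl INR.
    change (Derive (fun w => em_val 1 w) (- 4)) with (Derive (em_val 1) (- 4)).
    rewrite (is_derive_unique _ _ _ (D1 1 Rlt_0_1)). rewrite ln_1.
    match goal with |- @eq _ ?a ?b => change (@eq R a b) end. field.
  - rewrite !sum_Sn, IH. change (@plus R_AbelianMonoid) with Rplus.
    assert (P1 : 0 < INR (S N)) by (apply lt_0_INR; lia).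
    assert (P2 : 0 < INR (S (S N))) by (apply lt_0_INR; lia).
    assert (D3 : is_derive (zeta_val (S N)) (- 4)
      ((- ln (INR (S (S N))) * (INR (S (S N)) ^ 2 - INR (S (S N)) + / 6) + INR (S (S N)) / 2 - / 4)
       - (- ln (INR (S N)) * (INR (S N) ^ 2 - INR (S N) + / 6) + INR (S N) / 2 - / 4)
       - (- INR (S N) * (1 + 2 * ln (INR (S N)))))).
    { unfold zeta_val. apply (is_derive_minus (V := R_NormedModule)); [apply (is_derive_minus (V := R_NormedModule)) |]; auto. }
    rewrite (is_derive_unique _ _ _ D3).
    match goal with |- @eq _ ?a ?b => change (@eq R a b) end.
    set (l1 := ln (INR (S N))). set (l2 := ln (INR (S (S N)))).
    rewrite !S_INR. field.
Qed.

(** By cont_derive_sum the partial sums of the derivative at -1 are the sum of the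
    j ln j plus elementary terms, and they converge to a known multiple of zeta'(-1)
    plus a constant. *)
Theorem glaisher_asymptotics (zeta : C -> C) : is_riemann_zeta zeta ->
  is_lim_seq (fun n => log_hyperfact n -
     ((INR n ^ 2 / 2 + INR n / 2 + / 12) * ln (INR n) - INR n ^ 2 / 4))
    (ln (glaisher zeta)).
Proof.
  intros Hz. unfold glaisher. rewrite ln_exp, zeta_derive_at_m1, cont_value by auto.
  destruct (cont_pseries_derive (- 4)) as [HD HS]; [unfold Rabs; destruct Rcase_abs; lra |].
  set (D := Derive (PSeries cont_coef) (- 4)).
  assert (L : is_lim_seq (sum_n (fun n => Derive (zeta_val n) (- 4))) D).
  { unfold D. rewrite (is_derive_unique _ _ _ HD). exact (Series_correct _ HS). }
  apply is_lim_seq_incr_1.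
  apply is_lim_seq_ext with
    (fun N => / 2 * sum_n (fun n => Derive (zeta_val n) (- 4)) N + / 8).
  - intros N. rewrite cont_derive_sum. cbv zeta. unfold log_hyperfact.
    rewrite sum_Sn. change (@plus R_AbelianMonoid) with Rplus.
    match goal with |- @eq _ ?a ?b => change (@eq R a b) end.
    set (l1 := ln (INR (S N))). rewrite S_INR. field.
  - replace (1 / 12 - (- D / 2 - / 6 / 4)) with (/ 2 * D + / 8) by field.
    apply is_lim_seq_plus'; [| apply is_lim_seq_const].
    apply (is_lim_seq_scal_l _ (/ 2) D L).
Qed.

(** * Stirling's formula with its first correction *)

(** r + g decreases, r - g increases, and their difference tends to 0, so both have
    the limit of r, which lies between them. *)
Lemma lim_of_telescoping_bound (r g : nat -> R) :
  (forall n, Rabs (r (S n) - r n) <= g n - g (S n)) -> is_lim_seq g 0 ->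
  exists C : R, forall n, Rabs (r n - C) <= g n.
Proof.
  intros Hr Hg.
  assert (Hd : forall n, r (S n) + g (S n) <= r n + g n).
  { intros n. assert (T := Hr n). apply Rabs_le_between in T. lra. }
  assert (Hi : forall n, r n - g n <= r (S n) - g (S n)).
  { intros n. assert (T := Hr n). apply Rabs_le_between in T. lra. }
  assert (Hg0 : forall n, 0 <= g n).
  { intros n. refine (is_lim_seq_decr_compare g 0 Hg _ n).
    intros m. assert (T := Rabs_pos (r (S m) - r m)). generalize (Hr m); lra. }
  destruct (ex_finite_lim_seq_decr (fun n => r n + g n) (r O - g O)) as [C HC]; auto.
  { intros n. apply Rle_trans with (r n - g n); [| generalize (Hg0 n); lra].
    induction n; [lra |]. generalize (Hi n); lra. }
  exists C. intros n.
  assert (A := is_lim_seq_decr_compare _ _ HC Hd n). simpl in A.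
  assert (L : is_lim_seq (fun n => r n - g n) C).
  { apply is_lim_seq_ext with (fun n => (r n + g n) - 2 * g n); [intros; ring |].
    replace C with (C - 2 * 0) by ring.
    apply is_lim_seq_minus'; auto. apply (is_lim_seq_scal_l g 2 0 Hg). }
  assert (B := is_lim_seq_incr_compare _ _ L Hi n). simpl in B.
  apply Rabs_le. lra.
Qed.

Lemma is_lim_seq_inv_INR_S : is_lim_seq (fun n => / INR (S n)) 0.
Proof.
  apply (is_lim_seq_inv _ p_infty); [| easy].
  apply (is_lim_seq_incr_1 INR), is_lim_seq_INR.
Qed.

Definition stirling_rem (n : nat) : R :=
  ln (INR (fact n)) - (INR n * ln (INR n) - INR n + ln (INR n) / 2 + / (12 * INR n)).

Lemma ln_fact_S (n : nat) : ln (INR (fact (S n))) = ln (INR (fact n)) + ln (INR (S n)).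
Proof.
  change (fact (S n)) with (S n * fact n)%nat. rewrite mult_INR, ln_mult.
  - ring.
  - apply lt_0_INR; lia.
  - apply INR_fact_lt_0.
Qed.

(** Euler--Maclaurin with H = x ln x - x, whose derivative is ln. *)
Lemma stirling_rem_step (n : nat) :
  Rabs (stirling_rem (S (S n)) - stirling_rem (S n)) <= 6 * / INR (S n) ^ 4.
Proof.
  unfold stirling_rem. rewrite (ln_fact_S (S n)), (S_INR (S n)).
  assert (Ha : 1 <= INR (S n)) by (rewrite S_INR; generalize (pos_INR n); lra).
  set (a := INR (S n)) in *.
  set (H := fun (j : nat) (x : R) => match j with
    | 0%nat => x * ln x - x | 1%nat => ln x | 2%nat => / x
    | 3%nat => - / x ^ 2 | 4%nat => 2 * / x ^ 3 | _ => - 6 * / x ^ 4 end).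
  assert (E := euler_maclaurin_step H a (6 * / a ^ 4)).
  rewrite <- Rabs_Ropp. eapply Rle_trans; [| apply E].
  - right. f_equal. unfold H. field. lra.
  - intros j x Hj Hx.
    destruct j as [|[|[|[|[|j]]]]]; [..| lia]; unfold H; auto_derive;
      try (repeat split; try (apply Rmult_integral_contrapositive_currified); nra); field; lra.
  - intros x Hx. unfold H.
    rewrite Rabs_mult, Rabs_left, Rabs_pos_eq by (try lra; left; apply Rinv_0_lt_compat, pow_lt; lra).
    replace (- (-6)) with 6 by ring. apply Rmult_le_compat_l; [lra |].
    apply Rinv_le_contravar; [apply pow_lt; lra | apply pow_incr; lra].
Qed.

(** Telescoping: 6/a^4 <= 8/a^2 - 8/(a+1)^2 for a >= 1. *)
Lemma stirling_exists :
  exists C : R, forall n, Rabs (stirling_rem (S n) - C) <= 8 * / INR (S n) ^ 2.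
Proof.
  apply (lim_of_telescoping_bound (fun n => stirling_rem (S n)) (fun n => 8 * / INR (S n) ^ 2)).
  - intros n. eapply Rle_trans; [apply stirling_rem_step |].
    rewrite (S_INR (S n)).
    assert (Ha : 1 <= INR (S n)) by (rewrite S_INR; generalize (pos_INR n); lra).
    set (a := INR (S n)) in *.
    apply Rmult_le_reg_r with (a ^ 4 * (a + 1) ^ 2).
    { apply Rmult_lt_0_compat; apply pow_lt; lra. }
    replace (6 * / a ^ 4 * (a ^ 4 * (a + 1) ^ 2)) with (6 * (a + 1) ^ 2) by (field; lra).
    replace ((8 * / a ^ 2 - 8 * / (a + 1) ^ 2) * (a ^ 4 * (a + 1) ^ 2)) with
      (8 * (a ^ 2 * (2 * a + 1))) by (field; lra).
    nra.
  - replace 0 with (8 * (0 * 0)) by ring.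
    apply (is_lim_seq_scal_l _ 8 (0 * 0)).
    apply is_lim_seq_ext with (fun n => / INR (S n) * / INR (S n)).
    { intros n. rewrite <- Rinv_mult. f_equal. ring. }
    apply is_lim_seq_mult'; apply is_lim_seq_inv_INR_S.
Qed.

Definition wallis (n : nat) : R := RInt (fun x => sin x ^ n) 0 (PI / 2).

Lemma continuous_sin_pow (n : nat) (x : R) : continuous (fun x => sin x ^ n) x.
Proof. apply (ex_derive_continuous (V := R_NormedModule)). auto_derive. auto. Qed.

Lemma wallis_correct (n : nat) : is_RInt (fun x => sin x ^ n) 0 (PI / 2) (wallis n).
Proof.
  apply (RInt_correct (V := R_CompleteNormedModule)), (ex_RInt_continuous (V := R_CompleteNormedModule)).
  intros x _. apply continuous_sin_pow.
Qed.

Lemma wallis_0 : wallis 0 = PI / 2.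
Proof.
  unfold wallis. rewrite (RInt_ext _ (fun _ => 1)) by reflexivity.
  rewrite RInt_const. change scal with Rmult. ring.
Qed.

Lemma wallis_1 : wallis 1 = 1.
Proof.
  apply is_RInt_unique. apply is_RInt_ext with sin.
  { intros x _. real_eq. ring. }
  replace 1 with (minus (- cos (PI / 2)) (- cos 0)).
  - apply (is_RInt_derive (fun x => - cos x) sin).
    + intros x _. auto_derive; auto. ring.
    + intros x _. apply (ex_derive_continuous (V := R_NormedModule)). auto_derive. auto.
  - rewrite cos_PI2, cos_0. change (- 0 - - (1) = 1). ring.
Qed.

(** Integrate the derivative of - cos x sin^(n+1) x, which vanishes at both ends. *)
Lemma wallis_step (n : nat) : INR (n + 2) * wallis (n + 2) = INR (n + 1) * wallis n.
Proof.
  assert (H1 : is_RInt (fun x => INR (n + 2) * sin x ^ (n + 2) - INR (n + 1) * sin x ^ n) 0 (PI / 2)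
     (INR (n + 2) * wallis (n + 2) - INR (n + 1) * wallis n)).
  { apply (is_RInt_minus (V := R_NormedModule));
    apply (is_RInt_scal (V := R_NormedModule)); apply wallis_correct. }
  assert (H2 : is_RInt (fun x => INR (n + 2) * sin x ^ (n + 2) - INR (n + 1) * sin x ^ n) 0 (PI / 2)
     (minus (- cos (PI / 2) * sin (PI / 2) ^ (n + 1)) (- cos 0 * sin 0 ^ (n + 1)))).
  { apply (is_RInt_derive (fun x => - cos x * sin x ^ (n + 1))).
    - intros x _. auto_derive; auto.
      replace (pred (n + 1)) with n by lia.
      replace (n + 2)%nat with (S (S n)) by lia. replace (n + 1)%nat with (S n) by lia.
      rewrite !S_INR. cbn [pow]. assert (T := sin2_cos2 x). unfold Rsqr in T.
      replace (- cos x * (1 * cos x * ((INR n + 1) * sin x ^ n))) with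
        (- (cos x * cos x) * (INR n + 1) * sin x ^ n) by ring.
      replace (cos x * cos x) with (1 - sin x * sin x) by lra. ring.
    - intros x _. apply (ex_derive_continuous (V := R_NormedModule)). auto_derive. auto. }
  assert (E := is_RInt_unique _ _ _ _ H1). rewrite (is_RInt_unique _ _ _ _ H2) in E.
  change minus with Rminus in E. rewrite cos_PI2, sin_0 in E.
  rewrite pow_i in E by lia. lra.
Qed.

Lemma wallis_decr (n : nat) : wallis (S n) <= wallis n.
Proof.
  apply RInt_le.
  - generalize PI_RGT_0; lra.
  - eexists; apply wallis_correct.
  - eexists; apply wallis_correct.
  - intros x Hx. assert (0 <= sin x) by (apply sin_ge_0; generalize PI_RGT_0; lra).
    assert (T := SIN_bound x). simpl.
    assert (0 <= sin x ^ n) by now apply pow_le. nra.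
Qed.

(** The ratio of the central binomial coefficient to 4^n. *)
Definition central (n : nat) : R := INR (fact (2 * n)) / (4 ^ n * INR (fact n) ^ 2).

Lemma central_S (n : nat) : central (S n) = central n * (2 * INR n + 1) / (2 * INR n + 2).
Proof.
  unfold central. replace (2 * S n)%nat with (S (S (2 * n))) by lia.
  change (fact (S (S (2 * n)))) with (S (S (2 * n)) * (S (2 * n) * fact (2 * n)))%nat.
  change (fact (S n)) with (S n * fact n)%nat.
  rewrite !mult_INR, !S_INR, mult_INR. simpl (INR 2). cbn [pow].
  assert (A := INR_fact_neq_0 n). assert (B := pos_INR n).
  assert (C : 4 ^ n <> 0) by (apply pow_nonzero; lra).
  field. repeat split; auto; lra.
Qed.

Lemma central_pos (n : nat) : 0 < central n.
Proof.
  apply Rdiv_lt_0_compat; [apply INR_fact_lt_0 |].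
  apply Rmult_lt_0_compat; apply pow_lt; [lra | apply INR_fact_lt_0].
Qed.

Lemma wallis_even (n : nat) : wallis (2 * n) = PI / 2 * central n.
Proof.
  induction n as [|n IH].
  - change (2 * 0)%nat with O. rewrite wallis_0. unfold central. simpl. field.
  - rewrite central_S. assert (T := wallis_step (2 * n)).
    replace (2 * S n)%nat with (2 * n + 2)%nat by lia.
    rewrite !plus_INR, mult_INR, IH in T. simpl (INR 2) in T. simpl (INR 1) in T.
    assert (B := pos_INR n).
    apply Rmult_eq_reg_l with (2 * INR n + 2); [| lra].
    change ((1 + 1) * INR n + (1 + 1)) with (2 * INR n + 2) in T. rewrite T. field. lra.
Qed.

Lemma wallis_odd (n : nat) : wallis (2 * n + 1) = / (central n * (2 * INR n + 1)).
Proof.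
  induction n as [|n IH].
  - change (2 * 0 + 1)%nat with 1%nat. rewrite wallis_1. unfold central. simpl. field.
  - rewrite central_S. assert (T := wallis_step (2 * n + 1)).
    replace (2 * S n + 1)%nat with (2 * n + 1 + 2)%nat by lia.
    rewrite !plus_INR, mult_INR, IH in T. simpl (INR 2) in T. simpl (INR 1) in T.
    assert (B := pos_INR n). assert (P := central_pos n).
    rewrite S_INR.
    apply Rmult_eq_reg_l with (2 * INR n + 3); [| lra].
    replace (2 * INR n + 3) with ((1 + 1) * INR n + 1 + (1 + 1)) at 1 by ring.
    rewrite T. field. repeat split; lra.
Qed.

Lemma ln_ratio_lim (b : R) : 0 < b ->
  is_lim_seq (fun n => ln (INR (S n) + b) - ln (INR (S n))) 0.
Proof.
  intros Hb. apply is_lim_seq_le_le with (fun _ => 0) (fun n => b * / INR (S n)).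
  - intros n. assert (H : 0 < INR (S n)) by (apply lt_0_INR; lia). split.
    + assert (T : ln (INR (S n)) <= ln (INR (S n) + b)) by (apply ln_le; lra). lra.
    + rewrite <- ln_div by lra.
      replace ((INR (S n) + b) / INR (S n)) with (1 + b * / INR (S n)) by (field; lra).
      assert (P : 0 < b * / INR (S n)) by (apply Rmult_lt_0_compat; [lra | now apply Rinv_0_lt_compat]).
      rewrite <- (ln_exp (b * / INR (S n))) at 2. apply ln_le; [lra |].
      left. apply exp_ineq1. lra.
  - apply is_lim_seq_const.
  - replace (Finite 0) with (Rbar_mult b 0) by (simpl; f_equal; ring).
    apply is_lim_seq_scal_l, is_lim_seq_inv_INR_S.
Qed.

(** wallis decreases, so its values at 2n, 2n+1, 2n+2 squeeze central(n)^2 (2n+1)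
    towards 2 / pi. *)
Lemma central_lim : is_lim_seq (fun n => 2 * ln (central (S n)) + ln (INR (S n))) (- ln PI).
Proof.
  assert (HPI := PI_RGT_0).
  assert (L : is_lim_seq (fun n => 2 * ln (central (S n)) + ln (2 * INR (S n) + 1)) (- ln (PI / 2))).
  { apply is_lim_seq_le_le with (fun _ => - ln (PI / 2))
      (fun n => - ln (PI / 2) + (ln (2 * INR (S n) + 2) - ln (2 * INR (S n) + 1))).
    - intros n. assert (P := central_pos (S n)).
      assert (H1 := wallis_decr (2 * S n)). assert (H2 := wallis_decr (2 * S n + 1)).
      replace (S (2 * S n)) with (2 * S n + 1)%nat in H1 by lia.
      replace (S (2 * S n + 1)) with (2 * S (S n))%nat in H2 by lia.
      rewrite wallis_odd, wallis_even in H1. rewrite wallis_odd, wallis_even, central_S in H2.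
      assert (Hn : 0 < INR (S n)) by (apply lt_0_INR; lia).
      set (x := INR (S n)) in *. set (c := central (S n)) in *.
      set (p := PI / 2) in *. assert (Hp : 0 < p) by (unfold p; lra).
      assert (Q : 0 < c * (2 * x + 1)) by (apply Rmult_lt_0_compat; lra).
      apply ln_le in H1; [| now apply Rinv_0_lt_compat].
      apply ln_le in H2.
      2:{ apply Rmult_lt_0_compat; [lra |]. apply Rdiv_lt_0_compat; lra. }
      rewrite ln_Rinv, !ln_mult in H1 by lra.
      rewrite ln_Rinv, ln_mult in H2 by (try lra; apply Rdiv_lt_0_compat; lra).
      rewrite ln_div in H2 by lra. rewrite !ln_mult in H2 by lra.
      split; lra.
    - apply is_lim_seq_const.
    - replace (Finite (- ln (PI / 2))) with (Finite (- ln (PI / 2) + 0)) by (f_equal; ring).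
      apply is_lim_seq_plus'; [apply is_lim_seq_const |].
      apply is_lim_seq_le_le with (fun _ => 0) (fun n => ln (INR (S n) + 1) - ln (INR (S n))).
      + intros n. assert (Hn : 0 < INR (S n)) by (apply lt_0_INR; lia).
        set (x := INR (S n)) in *. split.
        * assert (ln (2 * x + 1) <= ln (2 * x + 2)) by (apply ln_le; lra). lra.
        * replace (2 * x + 2) with (2 * (x + 1)) by ring. rewrite ln_mult by lra.
          assert (T : ln (2 * x) <= ln (2 * x + 1)) by (apply ln_le; lra).
          rewrite ln_mult in T by lra. lra.
      + apply is_lim_seq_const.
      + apply ln_ratio_lim. lra. }
  apply is_lim_seq_ext with (fun n => (2 * ln (central (S n)) + ln (2 * INR (S n) + 1))
     - (ln (INR (S n) + / 2) - ln (INR (S n))) - ln 2).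
  - intros n. assert (Hn : 0 < INR (S n)) by (apply lt_0_INR; lia).
    replace (2 * INR (S n) + 1) with (2 * (INR (S n) + / 2)) by field.
    rewrite ln_mult by lra. ring.
  - replace (- ln PI) with (- ln (PI / 2) - 0 - ln 2) by (rewrite ln_div by lra; ring).
    apply is_lim_seq_minus'; [| apply is_lim_seq_const].
    apply is_lim_seq_minus'; [exact L |]. apply ln_ratio_lim. lra.
Qed.

Lemma ln_central (n : nat) :
  ln (central n) = ln (INR (fact (2 * n))) - 2 * INR n * ln 2 - 2 * ln (INR (fact n)).
Proof.
  assert (P := INR_fact_lt_0 n).
  assert (P4 : 0 < 4 ^ n) by (apply pow_lt; lra).
  assert (P2 : 0 < INR (fact n) ^ 2) by (apply pow_lt; lra).
  unfold central. rewrite ln_div, ln_mult, !ln_pow; auto; try lra.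
  - replace 4 with (2 * 2) by ring. rewrite ln_mult by lra. simpl (INR 2). ring.
  - apply INR_fact_lt_0.
  - now apply Rmult_lt_0_compat.
Qed.

(** The remainder has some limit C with error O(1/n^2); inserting the expansion into
    ln (central n) and comparing with central_lim determines C. *)
Theorem stirling :
  is_lim_seq (fun n => INR n * (ln (INR (fact n)) -
     (INR n * ln (INR n) - INR n + ln (INR n) / 2 + ln (2 * PI) / 2))) (/ 12).
Proof.
  assert (HPI := PI_RGT_0).
  destruct stirling_exists as [C HC].
  assert (HN : forall n, 1 <= INR (S n)).
  { intros n. rewrite S_INR. generalize (pos_INR n). lra. }
  assert (I0 := is_lim_seq_inv_INR_S).
  assert (Hrem : is_lim_seq (fun n => INR (S n) * (stirling_rem (S n) - C)) 0).
  { apply is_lim_seq_abs_0.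
    apply is_lim_seq_le_le with (fun _ => 0) (fun n => 8 * / INR (S n)).
    - intros n. split; [apply Rabs_pos |]. specialize (HC n). specialize (HN n).
      rewrite Rabs_mult, Rabs_pos_eq by lra.
      apply Rle_trans with (INR (S n) * (8 * / INR (S n) ^ 2)).
      + apply Rmult_le_compat_l; lra.
      + right. field. lra.
    - apply is_lim_seq_const.
    - replace (Finite 0) with (Rbar_mult 8 0) by (simpl; f_equal; ring).
      now apply is_lim_seq_scal_l. }
  set (r := fun n => ln (INR (fact n)) - (INR n * ln (INR n) - INR n + ln (INR n) / 2)).
  assert (Hr : is_lim_seq (fun n => r (S n)) C).
  { apply is_lim_seq_ext with (fun n => / INR (S n) * (INR (S n) * (stirling_rem (S n) - C)) + C + / 12 * / INR (S n)).
    - intros n. unfold r, stirling_rem. specialize (HN n). field. lra.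
    - replace (Finite C) with (Finite (0 * 0 + C + / 12 * 0)) by (f_equal; ring).
      apply is_lim_seq_plus'; [apply is_lim_seq_plus' |].
      + apply is_lim_seq_mult'; [exact I0 | exact Hrem].
      + apply is_lim_seq_const.
      + apply (is_lim_seq_scal_l _ (/ 12) 0 I0). }
  assert (EC : C = ln (2 * PI) / 2).
  { assert (L2 : is_lim_seq (fun n => r (2 * S n)%nat) C).
    { apply is_lim_seq_ext with (fun n => r (S (2 * n + 1))).
      - intros n. f_equal. lia.
      - apply (is_lim_seq_subseq (fun n => r (S n)) C (fun n => (2 * n + 1)%nat)); auto.
        apply eventually_subseq. intros n. lia. }
    assert (L : is_lim_seq (fun n => 2 * ln (central (S n)) + ln (INR (S n))) (2 * (C - 2 * C) + ln 2)).
    { apply is_lim_seq_ext with (fun n => 2 * (r (2 * S n)%nat - 2 * r (S n)) + ln 2).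
      - intros n. rewrite ln_central. unfold r. rewrite mult_INR. specialize (HN n).
        simpl (INR 2). change (1 + 1) with 2. rewrite ln_mult by lra. field.
      - apply is_lim_seq_plus'; [| apply is_lim_seq_const].
        apply (is_lim_seq_scal_l _ 2 (C - 2 * C)). apply is_lim_seq_minus'; auto.
        apply (is_lim_seq_scal_l _ 2 C Hr). }
    assert (E1 := is_lim_seq_unique _ _ L). rewrite (is_lim_seq_unique _ _ central_lim) in E1.
    injection E1 as E1. rewrite ln_mult by lra. lra. }
  apply is_lim_seq_incr_1.
  apply is_lim_seq_ext with (fun n => INR (S n) * (stirling_rem (S n) - C) + / 12).
  - intros n. rewrite EC. unfold stirling_rem. specialize (HN n). field. lra.
  - replace (Finite (/ 12)) with (Finite (0 + / 12)) by (f_equal; ring).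
    apply is_lim_seq_plus'; [exact Hrem | apply is_lim_seq_const].
Qed.

(** * Euler's integral and Gauss's limit *)

(** Convergence of the improper integral of f over (0, +oo), the one in the definition
    of Gamma. *)
Definition is_RInt_pos (f : R -> R) (l : R) : Prop :=
  is_RInt_gen f (at_right 0) (Rbar_locally p_infty) l.

Lemma half_line_eventually (P : R -> R -> Prop) (a0 b0 : R) : 0 < a0 ->
  (forall a b, 0 < a < a0 -> b0 < b -> P a b) ->
  filter_prod (at_right 0) (Rbar_locally p_infty) (fun ab => P (fst ab) (snd ab)).
Proof.
  intros Ha H. apply Filter_prod with (fun a => 0 < a < a0) (fun b => b0 < b).
  - exists (mkposreal _ Ha). intros y Hy Hy0. change (Rabs (y - 0) < a0) in Hy.
    apply Rabs_def2 in Hy. split; lra.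
  - now exists b0.
  - intros a b. apply H.
Qed.

(** For a nonnegative integrand the integrals over [a,b] grow with the interval, so
    boundedness alone gives a limit, namely their supremum. *)
Lemma is_RInt_pos_bounded (f : R -> R) (M : R) :
  (forall t, 0 < t -> continuous f t) -> (forall t, 0 < t -> 0 <= f t) ->
  (forall a b, 0 < a <= b -> RInt f a b <= M) -> exists l, is_RInt_pos f l.
Proof.
  intros Hc Hp HM.
  assert (Hex : forall a b, 0 < a -> a <= b -> ex_RInt f a b).
  { intros a b Ha Hb. apply (ex_RInt_continuous (V := R_CompleteNormedModule)).
    intros z Hz. apply Hc. rewrite Rmin_left in Hz by lra. lra. }
  destruct (completeness (fun y => exists a b, 0 < a <= b /\ y = RInt f a b)) as [l [Hub Hlub]].
  - exists M. intros y [a [b [Hab ->]]]. now apply HM.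
  - exists (RInt f 1 1), 1, 1. split; [lra | auto].
  - exists l. intros P [eps Heps]. unfold filtermapi.
    assert (Hclose : exists a0 b0, 0 < a0 <= b0 /\ l - eps < RInt f a0 b0).
    { apply NNPP. intros Hno.
      assert (l <= l - eps); [| generalize (cond_pos eps); lra].
      apply Hlub. intros y [a [b [Hab ->]]]. apply Rnot_lt_le. intros Hlt.
      apply Hno. now exists a, b. }
    destruct Hclose as [a0 [b0 [Hab0 Hgt]]].
    apply (half_line_eventually (fun a b => exists y, is_RInt f a b y /\ P y) a0 b0); [lra |].
    intros a b Ha Hb. exists (RInt f a b). split.
    + apply (RInt_correct (V := R_CompleteNormedModule)), Hex; lra.
    + apply Heps.
      assert (U : RInt f a b <= l) by (apply Hub; exists a, b; split; [lra | auto]).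
      assert (E1 := RInt_Chasles f a a0 b (Hex a a0 ltac:(lra) ltac:(lra)) (Hex a0 b ltac:(lra) ltac:(lra))).
      assert (E2 := RInt_Chasles f a0 b0 b (Hex a0 b0 ltac:(lra) ltac:(lra)) (Hex b0 b ltac:(lra) ltac:(lra))).
      change plus with Rplus in E1, E2.
      assert (P1 : 0 <= RInt f a a0) by (apply RInt_ge_0; [lra | apply Hex; lra | intros; apply Hp; lra]).
      assert (P2 : 0 <= RInt f b0 b) by (apply RInt_ge_0; [lra | apply Hex; lra | intros; apply Hp; lra]).
      change (Rabs (RInt f a b - l) < eps). apply Rabs_def1; generalize (cond_pos eps); lra.
Qed.

Lemma is_RInt_pos_le (f g : R -> R) (lf lg : R) :
  (forall t, 0 < t -> 0 <= f t <= g t) -> is_RInt_pos f lf -> is_RInt_pos g lg -> lf <= lg.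
Proof.
  intros H Hf Hg.
  apply Rle_trans with (1 := Rle_abs lf).
  apply (RInt_gen_norm (V := R_CompleteNormedModule) (Fa := at_right 0) (Fb := Rbar_locally p_infty) f g lf lg); auto.
  - apply (half_line_eventually (fun a b => a <= b) 1 1); [lra |]. intros; lra.
  - apply (half_line_eventually (fun a b => forall x, a <= x <= b -> norm (f x) <= g x) 1 1); [lra |].
    intros a b Ha Hb x Hx. change (Rabs (f x) <= g x). 
    assert (T := H x ltac:(lra)). rewrite Rabs_pos_eq; apply T.
Qed.

Lemma is_RInt_pos_ext (f g : R -> R) (l : R) :
  (forall t, 0 < t -> f t = g t) -> is_RInt_pos f l -> is_RInt_pos g l.
Proof.
  intros H Hf.
  refine (is_RInt_gen_ext (V := R_NormedModule) (Fa := at_right 0) (Fb := Rbar_locally p_infty)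
    f g l _ Hf).
  apply (half_line_eventually (fun a b => forall x, Rmin a b < x < Rmax a b -> f x = g x) 1 1); [lra |].
  intros a b Ha Hb x Hx. apply H. rewrite Rmin_left in Hx by lra. lra.
Qed.

Lemma is_RInt_pos_lin (f g : R -> R) (A B lf lg : R) :
  is_RInt_pos f lf -> is_RInt_pos g lg ->
  is_RInt_pos (fun t => A * f t + B * g t) (A * lf + B * lg).
Proof.
  intros Hf Hg. refine (is_RInt_gen_plus (V := R_NormedModule) (Fa := at_right 0) (Fb := Rbar_locally p_infty)
    (fun t => A * f t) (fun t => B * g t) _ _ _ _).
  - exact (is_RInt_gen_scal (V := R_NormedModule) (Fa := at_right 0) (Fb := Rbar_locally p_infty) f A lf Hf).
  - exact (is_RInt_gen_scal (V := R_NormedModule) (Fa := at_right 0) (Fb := Rbar_locally p_infty) g B lg Hg).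
Qed.

Lemma is_RInt_pos_derive (F f : R -> R) (la lb : R) :
  (forall t, 0 < t -> is_derive F t (f t)) -> (forall t, 0 < t -> continuous f t) ->
  filterlim F (at_right 0) (locally la) -> is_lim F p_infty lb ->
  is_RInt_pos f (lb - la).
Proof.
  intros HF Hf Ha Hb. apply is_RInt_pos_ext with (Derive F).
  { intros t Ht. apply is_derive_unique. auto. }
  refine (is_RInt_gen_Derive (Fa := at_right 0) (Fb := Rbar_locally p_infty) F la lb _ _ Ha Hb).
  - apply (half_line_eventually (fun a b => forall x, Rmin a b <= x <= Rmax a b -> ex_derive F x) 1 1); [lra |].
    intros a b H1 H2 x Hx. rewrite Rmin_left in Hx by lra. eexists. apply HF. lra.
  - apply (half_line_eventually (fun a b => forall x, Rmin a b <= x <= Rmax a b -> continuous (Derive F) x) 1 1); [lra |].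
    intros a b H1 H2 x Hx. rewrite Rmin_left in Hx by lra.
    apply continuous_ext_loc with f; [| apply Hf; lra].
    assert (Hx0 : 0 < x) by lra. exists (mkposreal x Hx0). intros y Hy.
    change (Rabs (y - x) < x) in Hy. apply Rabs_def2 in Hy.
    symmetry. apply is_derive_unique, HF. lra.
Qed.

(** Concavity of ln at the points u and 1 with weights y and 1 - y; applying
    ln z <= z - 1 to z = u/v and z = 1/v proves it. *)
Lemma bernoulli_Rpower (u y : R) : 0 < u -> 0 <= y <= 1 -> Rpower u y <= 1 + y * (u - 1).
Proof.
  intros Hu Hy.
  set (v := 1 + y * (u - 1)).
  assert (Hv : 0 < v).
  { destruct (Req_dec y 1) as [-> | Hne]; unfold v; [lra |]. nra. }
  assert (Hln : forall z, 0 < z -> ln z <= z - 1).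
  { intros z Hz. rewrite <- (ln_exp (z - 1)). apply ln_le; auto.
    destruct (Req_dec z 1) as [-> | Hne].
    - replace (1 - 1) with 0 by ring. rewrite exp_0. lra.
    - left. replace z with (1 + (z - 1)) at 1 by ring. apply exp_ineq1. lra. }
  assert (H1 := Hln (u / v) (Rdiv_lt_0_compat _ _ Hu Hv)).
  assert (H2 := Hln (1 / v) (Rdiv_lt_0_compat _ _ Rlt_0_1 Hv)).
  rewrite ln_div in H1, H2 by lra. rewrite ln_1 in H2.
  unfold Rpower. rewrite <- (exp_ln v) by auto.
  assert (T : y * ln u <= ln v).
  { assert (E : y * (u / v - 1) + (1 - y) * (1 / v - 1) = 0) by (unfold v in *; field; lra).
    nra. }
  destruct (Req_dec (y * ln u) (ln v)) as [-> | Hne]; [lra |].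
  left. apply exp_increasing. lra.
Qed.

Definition gamma_integrand (s t : R) : R := Rpower t (s - 1) * exp (- t).

Lemma gamma_integrand_continuous (s t : R) : 0 < t -> continuous (gamma_integrand s) t.
Proof.
  intros Ht. apply (ex_derive_continuous (V := R_NormedModule)). unfold gamma_integrand, Rpower.
  auto_derive. auto.
Qed.

Lemma gamma_integrand_pos (s t : R) : 0 <= gamma_integrand s t.
Proof. apply Rmult_le_pos; left; apply exp_pos. Qed.

(** Bernoulli's t^s <= 1 + s (t - 1) makes exp (1/s - 1) times the derivative of
    - exp (- t^s / s) a majorant of the integrand on the whole half-line, and that
    primitive is bounded. *)
Lemma gamma_exists (s : R) : 0 < s <= 1 -> exists l, is_RInt_pos (gamma_integrand s) l.
Proof.
  intros Hs. set (K := exp (/ s - 1)).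
  apply is_RInt_pos_bounded with K.
  - intros t Ht. now apply gamma_integrand_continuous.
  - intros t _. apply gamma_integrand_pos.
  - intros a b Hab.
    set (G := fun t => - K * exp (- (Rpower t s / s))).
    set (g := fun t => K * exp (- (Rpower t s / s)) * Rpower t (s - 1)).
    assert (HG : is_RInt g a b (minus (G b) (G a))).
    { apply (is_RInt_derive G g).
      - intros x Hx. rewrite Rmin_left in Hx by lra. unfold G, g.
        replace (Rpower x (s - 1)) with (Rpower x s / x).
        + unfold Rpower. auto_derive; [lra |]. unfold Rdiv. field. lra.
        + unfold Rminus. rewrite Rpower_plus, Rpower_Ropp, Rpower_1 by lra. reflexivity.
      - intros x Hx. rewrite Rmin_left in Hx by lra.
        apply (ex_derive_continuous (V := R_NormedModule)). unfold g, Rpower. auto_derive. lra. }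
    apply Rle_trans with (RInt g a b).
    + apply RInt_le; [lra | | eexists; exact HG |].
      * apply (ex_RInt_continuous (V := R_CompleteNormedModule)). intros z Hz.
        rewrite Rmin_left in Hz by lra. apply gamma_integrand_continuous. lra.
      * intros x Hx. unfold gamma_integrand, g. rewrite Rmult_comm.
        apply Rmult_le_compat_r; [left; apply exp_pos |].
        unfold K. rewrite <- exp_plus.
        assert (B := bernoulli_Rpower x s ltac:(lra) ltac:(lra)).
        assert (T : Rpower x s / s <= / s + x - 1).
        { apply Rmult_le_reg_r with s; [lra |].
          replace (Rpower x s / s * s) with (Rpower x s) by (field; lra).
          replace ((/ s + x - 1) * s) with (1 + s * (x - 1)) by (field; lra). exact B. }
        destruct (Req_dec (- x) (/ s - 1 + - (Rpower x s / s))) as [-> | Hne]; [lra |].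
        left. apply exp_increasing. lra.
    + rewrite (is_RInt_unique _ _ _ _ HG). change minus with Rminus. unfold G.
      assert (HK : 0 < K) by apply exp_pos.
      assert (P1 := exp_pos (- (Rpower b s / s))).
      assert (P2 : exp (- (Rpower a s / s)) <= 1).
      { rewrite <- exp_0. left. apply exp_increasing.
        assert (0 < Rpower a s / s); [| lra].
        apply Rdiv_lt_0_compat; [apply exp_pos | lra]. }
      nra.
Qed.

Lemma gamma_one : is_RInt_pos (gamma_integrand 1) 1.
Proof.
  apply is_RInt_pos_ext with (fun t => exp (- t)).
  { intros t Ht. unfold gamma_integrand. replace (1 - 1) with 0 by ring.
    rewrite Rpower_O by auto. ring. }
  replace 1 with (0 - - exp (- 0)) by (rewrite Ropp_0, exp_0; ring).
  apply is_RInt_pos_derive with (fun t => - exp (- t)).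
  - intros t Ht. auto_derive; auto. ring.
  - intros t Ht. apply (ex_derive_continuous (V := R_NormedModule)). auto_derive. auto.
  - apply (filterlim_filter_le_1 (F := locally 0) (G := at_right 0)).
    + apply filter_le_within.
    + apply (ex_derive_continuous (V := R_NormedModule) (fun t => - exp (- t))). auto_derive. auto.
  - replace (Finite 0) with (Rbar_opp 0) by (simpl; f_equal; ring).
    apply is_lim_opp. apply (is_lim_comp exp Ropp p_infty 0 m_infty).
    + apply is_lim_exp_m.
    + apply (is_lim_opp (fun x => x) p_infty p_infty). apply is_lim_id.
    + exists 0. intros; discriminate.
Qed.

(** Integration by parts; the boundary terms t^s exp(-t) vanish at both ends. *)
Lemma gamma_step (s l : R) : 0 < s ->
  is_RInt_pos (gamma_integrand s) l -> is_RInt_pos (gamma_integrand (s + 1)) (s * l).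
Proof.
  intros Hs Hl.
  set (F := fun t => - (Rpower t s * exp (- t))).
  set (f := fun t => gamma_integrand (s + 1) t - s * gamma_integrand s t).
  assert (HF : is_RInt_pos f (0 - 0)).
  { apply is_RInt_pos_derive with F.
    - intros t Ht. unfold F, f, gamma_integrand. replace (s + 1 - 1) with s by ring.
      replace (Rpower t (s - 1)) with (Rpower t s / t).
      + unfold Rpower. auto_derive; [lra |]. field. lra.
      + unfold Rminus. rewrite Rpower_plus, Rpower_Ropp, Rpower_1 by lra. reflexivity.
    - intros t Ht. apply (ex_derive_continuous (V := R_NormedModule)).
      unfold f, gamma_integrand, Rpower. auto_derive. lra.
    - apply filterlim_locally. intros eps.
      (* d is chosen so that d^s = eps. *)
      set (d := Rpower eps (/ s)).
      assert (Hd : 0 < d) by apply exp_pos.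
      exists (mkposreal d Hd). intros y Hy Hy0. change (Rabs (y - 0) < d) in Hy.
      rewrite Rminus_0_r, Rabs_pos_eq in Hy by lra.
      change (Rabs (F y - 0) < eps). unfold F. rewrite Rminus_0_r, Rabs_Ropp, Rabs_pos_eq
        by (apply Rmult_le_pos; left; apply exp_pos).
      apply Rle_lt_trans with (Rpower y s * 1).
      + apply Rmult_le_compat_l; [left; apply exp_pos |].
        rewrite <- exp_0. left. apply exp_increasing. lra.
      + rewrite Rmult_1_r. replace (pos eps) with (Rpower d s).
        * apply Rlt_Rpower_l; lra.
        * unfold d. rewrite Rpower_mult, Rinv_l, Rpower_1 by (try lra; apply cond_pos). reflexivity.
    - replace (Finite 0) with (Rbar_opp 0) by (simpl; f_equal; ring).
      apply is_lim_opp.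
      apply is_lim_ext_loc with (fun t => exp (t * (s * (ln t / t) - 1))).
      { exists 0. intros t Ht. unfold Rpower. rewrite <- exp_plus. f_equal. field. lra. }
      apply (is_lim_comp exp _ p_infty 0 m_infty).
      + apply is_lim_exp_m.
      + replace m_infty with (Rbar_mult p_infty (-1)).
        * apply (is_lim_mult (fun t => t) (fun t => s * (ln t / t) - 1) p_infty p_infty (-1)).
          -- apply is_lim_id.
          -- replace (Finite (-1)) with (Finite (s * 0 - 1)) by (f_equal; ring).
             apply (is_lim_minus' (fun t => s * (ln t / t)) (fun _ => 1) p_infty (s * 0) 1).
             ++ apply (is_lim_scal_l (fun t => ln t / t) s p_infty 0). apply is_lim_div_ln_p.
             ++ apply is_lim_const.
          -- simpl. lra.
        * unfold Rbar_mult, Rbar_mult'. destruct Rle_dec as [H | H]; [exfalso; lra | reflexivity].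
      + exists 0. intros; discriminate. }
  apply is_RInt_pos_ext with (fun t => 1 * f t + s * gamma_integrand s t).
  - intros t _. unfold f. ring.
  - replace (s * l) with (1 * (0 - 0) + s * l) by ring. now apply is_RInt_pos_lin.
Qed.

(** Replace t^y by its tangent line at t = s, where the mean of the Gamma density sits:
    the two resulting integrals are l and s l, and the linear terms cancel exactly.
    Used with y = x and with y = 1 - x it gives both bounds in gamma_gauss. *)
Lemma gamma_interpolate (s y l l' : R) : 0 < s -> 0 <= y <= 1 ->
  is_RInt_pos (gamma_integrand s) l -> is_RInt_pos (gamma_integrand (s + y)) l' ->
  l' <= Rpower s y * l.
Proof.
  intros Hs Hy Hl Hl'.
  replace (Rpower s y * l) with (Rpower s y * (1 - y) * l + Rpower s y * y / s * (s * l)) by (field; lra).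
  refine (is_RInt_pos_le _ _ _ _ _ Hl' (is_RInt_pos_lin _ _ _ _ _ _ Hl (gamma_step s l Hs Hl))).
  intros t Ht. split; [apply gamma_integrand_pos |].
  unfold gamma_integrand.
  replace (s + y - 1) with (s - 1 + y) by ring. replace (s + 1 - 1) with (s - 1 + 1) by ring.
  rewrite !Rpower_plus, Rpower_1 by auto.
  assert (B := bernoulli_Rpower (t / s) y ltac:(now apply Rdiv_lt_0_compat) Hy).
  assert (E : Rpower t y = Rpower s y * Rpower (t / s) y).
  { rewrite Rpower_mult_distr; [f_equal; field; lra | auto | now apply Rdiv_lt_0_compat]. }
  rewrite E.
  assert (P : 0 < Rpower t (s - 1) * exp (- t) * Rpower s y).
  { repeat apply Rmult_lt_0_compat; apply exp_pos. }
  apply Rmult_le_compat_l with (r := Rpower t (s - 1) * exp (- t) * Rpower s y) in B; [| lra].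
  eapply Rle_trans; [| eapply Rle_trans; [exact B |]].
  - right. ring.
  - right. field. lra.
Qed.

Fixpoint rising (x : R) (n : nat) : R :=
  match n with O => 1 | S n' => rising x n' * (INR n' + x) end.

Lemma gamma_shift (x l : R) (n : nat) : 0 < x -> is_RInt_pos (gamma_integrand x) l ->
  is_RInt_pos (gamma_integrand (INR n + x)) (rising x n * l).
Proof.
  intros Hx Hl. induction n as [|n IH].
  - simpl. rewrite Rplus_0_l, Rmult_1_l. exact Hl.
  - rewrite S_INR. replace (INR n + 1 + x) with ((INR n + x) + 1) by ring.
    simpl. replace (rising x n * (INR n + x) * l) with ((INR n + x) * (rising x n * l)) by ring.
    apply gamma_step; [generalize (pos_INR n); lra | exact IH].
Qed.

Lemma gamma_fact (n : nat) : is_RInt_pos (gamma_integrand (INR n + 1)) (INR (fact n)).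
Proof.
  assert (E : INR (fact n) = rising 1 n * 1).
  { induction n as [|n IH]; [simpl; ring |].
    change (fact (S n)) with (S n * fact n)%nat. rewrite mult_INR, IH, S_INR. simpl. ring. }
  rewrite E. apply gamma_shift; [lra | apply gamma_one].
Qed.

Lemma Gamma_unique (s l : R) : is_RInt_pos (gamma_integrand s) l -> Gamma s = l.
Proof. intros H. exact (is_RInt_gen_unique (V := R_CompleteNormedModule) (Fa := at_right 0) (Fb := Rbar_locally p_infty) _ l H). Qed.

Lemma rising_pos (x : R) (n : nat) : 0 < x -> 0 < rising x n.
Proof.
  intros Hx. induction n as [|n IH]; simpl; [lra |].
  apply Rmult_lt_0_compat; auto. generalize (pos_INR n); lra.
Qed.

(** From (S n)! = Gamma (S n + 1) one gets the lower bound and from n! = Gamma (S n) the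
    upper bound on Gamma (S n + x) = rising x (S n) * Gamma x; they differ by a
    logarithm of ratio tending to 1. *)
Theorem gamma_gauss (x : R) : 0 < x < 1 ->
  is_lim_seq (fun n => ln (rising x (S n)) - ln (INR (fact (S n))) - (x - 1) * ln (INR (S n)))
    (- ln (Gamma x)).
Proof.
  intros Hx. destruct (gamma_exists x) as [l Hl]; [lra |].
  rewrite (Gamma_unique _ _ Hl).
  assert (Hl0 : 0 < l).
  { assert (T := gamma_interpolate x (1 - x) l 1 ltac:(lra) ltac:(lra) Hl).
    replace (x + (1 - x)) with 1 in T by ring. specialize (T gamma_one).
    assert (P : 0 < Rpower x (1 - x)) by apply exp_pos.
    apply Rmult_lt_reg_l with (Rpower x (1 - x)); lra. }
  assert (Hb : forall n, 
    - ln l - (1 - x) * (ln (INR (S n) + x) - ln (INR (S n))) <=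
    ln (rising x (S n)) - ln (INR (fact (S n))) - (x - 1) * ln (INR (S n)) <= - ln l).
  { intros n. assert (Hn : 0 < INR (S n)) by (apply lt_0_INR; lia).
    assert (HR := rising_pos x (S n) ltac:(lra)).
    assert (G := gamma_shift x l (S n) ltac:(lra) Hl).
    assert (F0 := gamma_fact n). rewrite <- S_INR in F0.
    assert (F1 := gamma_fact (S n)).
    assert (U := gamma_interpolate (INR (S n)) x (INR (fact n)) (rising x (S n) * l) Hn ltac:(lra) F0 G).
    assert (L := gamma_interpolate (INR (S n) + x) (1 - x) (rising x (S n) * l) (INR (fact (S n))) ltac:(lra) ltac:(lra) G).
    replace (INR (S n) + x + (1 - x)) with (INR (S n) + 1) in L by ring.
    specialize (L F1).
    assert (Pf := INR_fact_lt_0 n). assert (Pf' := INR_fact_lt_0 (S n)).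
    apply ln_le in U; [| now apply Rmult_lt_0_compat].
    apply ln_le in L; [| auto].
    assert (PR : 0 < rising x (S n) * l) by now apply Rmult_lt_0_compat.
    rewrite (ln_mult (rising x (S n)) l), ln_mult in U by (auto; apply exp_pos).
    rewrite ln_mult, (ln_mult (rising x (S n)) l) in L by (auto; apply exp_pos).
    unfold Rpower in U, L. rewrite ln_exp in U, L.
    assert (E : ln (INR (fact (S n))) = ln (INR (S n)) + ln (INR (fact n))).
    { change (fact (S n)) with (S n * fact n)%nat. rewrite mult_INR, ln_mult; auto. }
    rewrite E in *. split; lra. }
  apply is_lim_seq_le_le with (1 := Hb); [| apply is_lim_seq_const].
  replace (Finite (- ln l)) with (Finite (- ln l - (1 - x) * 0)) by (f_equal; ring).
  apply is_lim_seq_minus'; [apply is_lim_seq_const |].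
  apply (is_lim_seq_scal_l _ (1 - x) 0). apply ln_ratio_lim. lra.
Qed.

(** * The product of the (k nu)! *)

Lemma prod_fact_S (k n : nat) : prod_fact k (S n) = prod_fact k n * INR (fact (k * S n)).
Proof.
  unfold prod_fact. rewrite seq_S, map_app, fold_right_app. simpl.
  rewrite Rmult_1_r.
  generalize (INR (fact (k * S n))). intros c.
  induction (map (fun nu => INR (fact (k * nu))) (seq 1 n)) as [|a l IH]; simpl; [ring |].
  rewrite IH. ring.
Qed.

Lemma prod_fact_pos (k n : nat) : 0 < prod_fact k n.
Proof.
  induction n as [|n IH]; [unfold prod_fact; simpl; lra |].
  rewrite prod_fact_S. apply Rmult_lt_0_compat; auto. apply INR_fact_lt_0.
Qed.

Lemma sum_n_shift (f : nat -> R) (a k : nat) :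
  sum_n f (a + k) = sum_n f a + sum_n_m (fun v => f (a + v)%nat) 1 k.
Proof.
  induction k as [|k IH].
  - rewrite sum_n_m_zero by lia. change zero with 0. rewrite Nat.add_0_r. now rewrite Rplus_0_r.
  - rewrite sum_n_Sm by lia. replace (a + S k)%nat with (S (a + k)) by lia.
    rewrite sum_Sn, IH. change plus with Rplus. real_eq. ring.
Qed.

Lemma ln_fact_shift (a k : nat) :
  ln (INR (fact (a + k))) = ln (INR (fact a)) + sum_n_m (fun v => ln (INR (a + v))) 1 k.
Proof.
  induction k as [|k IH].
  - rewrite sum_n_m_zero by lia. change zero with 0. rewrite Nat.add_0_r. real_eq. ring.
  - rewrite sum_n_Sm by lia. replace (a + S k)%nat with (S (a + k)) by lia.
    rewrite ln_fact_S, IH. change plus with Rplus. real_eq. ring.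
Qed.

Lemma sum_n_m_lin (f g : nat -> R) (A B : R) (p q : nat) :
  sum_n_m (fun v => A * f v + B * g v) p q = A * sum_n_m f p q + B * sum_n_m g p q.
Proof.
  rewrite (sum_n_m_plus (G := R_AbelianMonoid) (fun v => A * f v) (fun v => B * g v)).
  rewrite !(sum_n_m_mult_l (K := R_Ring)). reflexivity.
Qed.

(** The sum of (v/k) ln (km + v) over v = 1..k and m < n, with km + v = k (m + v/k), so
    that Gauss's limit at v/k applies to the inner sum. *)
Definition log_rising_sum (k n : nat) : R :=
  sum_n_m (fun v => INR v / INR k * (INR n * ln (INR k) + ln (rising (INR v / INR k) n))) 1 k.

(** The integer km + v, with 1 <= v <= k, is a factor of (k nu)! exactly for nu > m, so its logarithm occurs
    n - m = n - (km + v)/k + v/k times; the three summands collect these weights. *)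
Lemma ln_prod_fact (k n : nat) : (1 <= k)%nat ->
  ln (prod_fact k n) =
  INR n * ln (INR (fact (k * n))) - log_hyperfact (k * n) / INR k + log_rising_sum k n.
Proof.
  intros Hk. assert (Pk : 0 < INR k) by (apply lt_0_INR; lia).
  assert (Hext : forall (f g : nat -> R), (forall v, (1 <= v <= k)%nat -> f v = g v) -> 
     sum_n_m f 1 k = sum_n_m g 1 k).
  { intros f g H. now apply sum_n_m_ext_loc. }
  induction n as [|n IH].
  - unfold log_rising_sum. rewrite (Hext _ (fun v => 0 * 0 + 0 * 0)).
    + rewrite sum_n_m_lin. rewrite Nat.mul_0_r. unfold log_hyperfact. rewrite sum_O.
      unfold prod_fact. simpl. rewrite ln_1. field. lra.
    + intros v _. simpl. rewrite ln_1. ring.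
  - rewrite prod_fact_S, ln_mult, IH by (apply prod_fact_pos || apply INR_fact_lt_0).
    replace (k * S n)%nat with (k * n + k)%nat by lia.
    set (l := fun v => ln (INR (k * n + v))).
    assert (E1 := ln_fact_shift (k * n) k). fold l in E1.
    assert (E2 : log_hyperfact (k * n + k) = log_hyperfact (k * n) + 
      (INR k * INR n * sum_n_m l 1 k + 1 * sum_n_m (fun v => INR v * l v) 1 k)).
    { unfold log_hyperfact. rewrite sum_n_shift, <- sum_n_m_lin. f_equal.
      apply Hext. intros v _. unfold l. rewrite plus_INR, mult_INR. ring. }
    assert (E3 : log_rising_sum k (S n) = log_rising_sum k n + / INR k * sum_n_m (fun v => INR v * l v) 1 k).
    { transitivity (1 * log_rising_sum k n + / INR k * sum_n_m (fun v => INR v * l v) 1 k); [| ring].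
      unfold log_rising_sum. rewrite <- sum_n_m_lin.
      apply Hext. intros v Hv. 
      assert (Pv : 0 < INR v) by (apply lt_0_INR; lia).
      assert (Px : 0 < INR v / INR k) by (now apply Rdiv_lt_0_compat).
      unfold l. simpl rising. rewrite ln_mult; [| now apply rising_pos | generalize (pos_INR n); lra].
      replace (INR (k * n + v)) with (INR k * (INR n + INR v / INR k)) by
        (rewrite plus_INR, mult_INR; field; lra).
      rewrite (ln_mult (INR k)); [| auto | generalize (pos_INR n); lra].
      rewrite S_INR. field. lra. }
    rewrite E1, E2, E3, S_INR. field. lra.
Qed.

Lemma is_lim_seq_sum_n_m (f : nat -> nat -> R) (g : nat -> R) (p q : nat) :
  (forall v, (p <= v <= q)%nat -> is_lim_seq (fun n => f v n) (g v)) ->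
  is_lim_seq (fun n => sum_n_m (fun v => f v n) p q) (sum_n_m g p q).
Proof.
  intros H. destruct (Nat.le_gt_cases p q) as [Hpq | Hpq].
  - induction q as [|q IH].
    + replace p with O in * by lia.
      apply is_lim_seq_ext with (fun n => f O n); [intros n; now rewrite sum_n_n |].
      rewrite sum_n_n. apply H. lia.
    + apply is_lim_seq_ext with (fun n => sum_n_m (fun v => f v n) p q + f (S q) n).
      { intros n. now rewrite sum_n_Sm by lia. }
      rewrite sum_n_Sm by lia. apply is_lim_seq_plus'; [| apply H; lia].
      destruct (Nat.eq_dec p (S q)) as [-> | Hne].
      * apply is_lim_seq_ext with (fun _ => 0).
        { intros n. now rewrite sum_n_m_zero by lia. }
        rewrite sum_n_m_zero by lia. apply is_lim_seq_const.
      * apply IH; [intros v Hv; apply H; lia | lia].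
  - apply is_lim_seq_ext with (fun _ => 0).
    { intros n. now rewrite sum_n_m_zero by lia. }
    rewrite sum_n_m_zero by lia. apply is_lim_seq_const.
Qed.

Lemma sum_ratio (j k : nat) : (1 <= k)%nat ->
  sum_n_m (fun v => INR v / INR k) 1 j = INR j * (INR j + 1) / (2 * INR k).
Proof.
  intros Hk. assert (Pk : 0 < INR k) by (apply lt_0_INR; lia).
  induction j as [|j IH].
  - rewrite sum_n_m_zero by lia. change zero with 0. simpl. field. lra.
  - rewrite sum_n_Sm, IH by lia. change plus with Rplus. rewrite S_INR. real_eq. field. lra.
Qed.

Lemma sum_ratio_sqr (j k : nat) : (1 <= k)%nat ->
  sum_n_m (fun v => (INR v / INR k) ^ 2) 1 j =
  INR j * (INR j + 1) * (2 * INR j + 1) / (6 * INR k ^ 2).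
Proof.
  intros Hk. assert (Pk : 0 < INR k) by (apply lt_0_INR; lia).
  induction j as [|j IH].
  - rewrite sum_n_m_zero by lia. change zero with 0. simpl. field. lra.
  - rewrite sum_n_Sm, IH by lia. change plus with Rplus. rewrite S_INR. real_eq. field. lra.
Qed.

Lemma sum_n_m_last (f : nat -> R) (k : nat) : (1 <= k)%nat ->
  sum_n_m f 1 k = sum_n_m f 1 (k - 1) + f k.
Proof.
  intros Hk. destruct k as [|k]; [lia |].
  replace (S k - 1)%nat with k by lia. now rewrite sum_n_Sm by lia.
Qed.

Lemma rising_1 (n : nat) : rising 1 n = INR (fact n).
Proof.
  induction n as [|n IH]; [reflexivity |].
  change (fact (S n)) with (S n * fact n)%nat. rewrite mult_INR, S_INR. simpl. rewrite IH. ring.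
Qed.

Definition log_fact_const (A : R) (k : nat) : R :=
  - (INR k + 1 / INR k) * ln A
    + 1 / (12 * INR k)
    - 1 / (12 * INR k) * ln (INR k)
    + INR k / 4 * ln (2 * PI)
    - sum_n_m (fun nu : nat => INR nu / INR k * ln (Gamma (INR nu / INR k))) 1 (k - 1).

Lemma ln_prod_fact_asym (A F : R) (k n : nat) : 0 < A -> 0 < F -> (1 <= k)%nat -> (1 <= n)%nat ->
  0 < prod_fact_asym A F k n /\
  ln (prod_fact_asym A F k n) = ln F + INR k * ln A + ln (2 * PI) / 4
   + INR k / 2 * INR n * (INR n + 1) * (ln (INR k) + ln (INR n) - 3 / 2)
   + INR n / 2 * (ln (2 * PI) + ln (INR k) + (INR k / 2 - 1) + ln (INR n))
   + (1 / 4 + INR k / 12 + 1 / (12 * INR k)) * ln (INR n).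
Proof.
  intros HA HF Hk Hn.
  assert (Pk : 0 < INR k) by (apply lt_0_INR; lia).
  assert (Pn : 0 < INR n) by (apply lt_0_INR; lia).
  assert (HPI := PI_RGT_0).
  assert (PA : 0 < A ^ k) by now apply pow_lt.
  assert (PR : forall a b, 0 < Rpower a b) by (intros; apply exp_pos).
  assert (Pe := fun x => exp_pos x).
  unfold prod_fact_asym. split.
  { repeat apply Rmult_lt_0_compat; auto. }
  assert (L : forall a b, ln (Rpower a b) = b * ln a) by (intros; unfold Rpower; apply ln_exp).
  rewrite !(ln_mult (_ * _)) by (repeat apply Rmult_lt_0_compat; auto).
  rewrite (ln_mult F) by auto. rewrite !L, ln_pow by auto.
  rewrite ln_div by (auto; apply Rmult_lt_0_compat; auto).
  rewrite (ln_mult (INR k) (INR n)) by auto.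
  assert (Q0 : 0 < 2 * PI) by lra.
  assert (Q1 : 0 < 2 * PI * INR k) by now apply Rmult_lt_0_compat.
  assert (Q2 : 0 < 2 * PI * INR k * exp (INR k / 2 - 1)) by (apply Rmult_lt_0_compat; auto).
  rewrite (ln_mult _ _ Q2 Pn), (ln_mult _ _ Q1 (Pe _)), (ln_mult _ _ Q0 Pk).
  rewrite !ln_exp. field. lra.
Qed.

Lemma prod_fact_log_limit (zeta : C -> C) (k : nat) : is_riemann_zeta zeta -> (1 <= k)%nat ->
  is_lim_seq (fun n => ln (prod_fact k (S n)) - ln (prod_fact_asym (glaisher zeta) 1 k (S n)))
    (log_fact_const (glaisher zeta) k).
Proof.
  intros Hz Hk.
  assert (Pk : 0 < INR k) by (apply lt_0_INR; lia).
  assert (HA : 0 < glaisher zeta) by apply exp_pos.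
  set (A := glaisher zeta) in *.
  set (eps := fun n => ln (INR (fact n)) -
     (INR n * ln (INR n) - INR n + ln (INR n) / 2 + ln (2 * PI) / 2)).
  set (del := fun n => log_hyperfact n -
     ((INR n ^ 2 / 2 + INR n / 2 + / 12) * ln (INR n) - INR n ^ 2 / 4)).
  set (rho := fun v n => ln (rising (INR v / INR k) (S n)) - ln (INR (fact (S n)))
     - (INR v / INR k - 1) * ln (INR (S n))).
  assert (Hsub : filterlim (fun n => k * S n)%nat eventually eventually).
  { apply eventually_subseq. intros n. nia. }
  assert (L1 : is_lim_seq (fun n => INR (k * S n) * eps (k * S n)%nat) (/ 12)).
  { exact (is_lim_seq_subseq _ _ _ Hsub stirling). }
  assert (L2 : is_lim_seq (fun n => del (k * S n)%nat) (ln A)).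
  { exact (is_lim_seq_subseq _ _ _ Hsub (glaisher_asymptotics zeta Hz)). }
  assert (L3 : is_lim_seq (fun n => eps (S n)) 0).
  { apply is_lim_seq_ext with (fun n => / INR (S n) * (INR (S n) * eps (S n))).
    - intros n. field. apply not_0_INR. lia.
    - replace 0 with (0 * / 12) by ring. apply is_lim_seq_mult'.
      + apply is_lim_seq_inv_INR_S.
      + apply (is_lim_seq_incr_1 (fun n => INR n * eps n)). exact stirling. }
  assert (L4 : is_lim_seq (fun n => sum_n_m (fun v => INR v / INR k * rho v n) 1 (k - 1))
    (sum_n_m (fun v => INR v / INR k * - ln (Gamma (INR v / INR k))) 1 (k - 1))).
  { apply (is_lim_seq_sum_n_m (fun v n => INR v / INR k * rho v n)
      (fun v => INR v / INR k * - ln (Gamma (INR v / INR k)))).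
    intros v Hv. apply (is_lim_seq_scal_l _ _ (- ln (Gamma (INR v / INR k)))).
    apply gamma_gauss.
    assert (0 < INR v) by (apply lt_0_INR; lia).
    assert (INR v < INR k) by (apply lt_INR; lia).
    split; [now apply Rdiv_lt_0_compat |].
    apply Rmult_lt_reg_r with (INR k); auto. unfold Rdiv. rewrite Rmult_assoc, Rinv_l; lra. }
  apply is_lim_seq_ext with (fun n => / INR k * (INR (k * S n) * eps (k * S n)%nat)
     - / INR k * del (k * S n)%nat + (INR k + 1) / 2 * eps (S n)
     + sum_n_m (fun v => INR v / INR k * rho v n) 1 (k - 1)
     + (INR k / 4 * ln (2 * PI) - INR k * ln A - / (12 * INR k) * ln (INR k))).
  - intros n.
    destruct (ln_prod_fact_asym A 1 k (S n) HA Rlt_0_1 Hk ltac:(lia)) as [_ ->].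
    rewrite ln_1, ln_prod_fact by auto.
    assert (Pn : 0 < INR (S n)) by (apply lt_0_INR; lia).
    assert (E : log_rising_sum k (S n) =
      (INR (S n) * ln (INR k) + ln (INR (fact (S n))) - ln (INR (S n))) * (INR (k - 1) * (INR (k - 1) + 1) / (2 * INR k))
      + ln (INR (S n)) * (INR (k - 1) * (INR (k - 1) + 1) * (2 * INR (k - 1) + 1) / (6 * INR k ^ 2))
      + 1 * sum_n_m (fun v => INR v / INR k * rho v n) 1 (k - 1)
      + (INR (S n) * ln (INR k) + ln (INR (fact (S n))))).
    (* The summand v = k has x = 1, where rising 1 n = n! replaces Gauss's limit. *)
    { unfold log_rising_sum. rewrite sum_n_m_last by auto. f_equal.
      - rewrite <- sum_ratio, <- sum_ratio_sqr by auto.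
        rewrite <- sum_n_m_lin.
        rewrite <- (Rmult_1_l (sum_n_m (fun v => _ * (INR v / INR k) + _) _ _)).
        rewrite <- sum_n_m_lin.
        apply sum_n_m_ext_loc. intros v _. unfold rho. real_eq. field. lra.
      - replace (INR k / INR k) with 1 by (field; lra).
        rewrite rising_1. ring. }
    rewrite E. rewrite minus_INR by auto. change (INR 1) with 1.
    unfold eps, del. rewrite !mult_INR. rewrite (ln_mult (INR k) (INR (S n))) by auto.
    field. lra.
  - unfold log_fact_const.
    set (SS := sum_n_m (fun v => INR v / INR k * - ln (Gamma (INR v / INR k))) 1 (k - 1)) in *.
    assert (ES : sum_n_m (fun nu => INR nu / INR k * ln (Gamma (INR nu / INR k))) 1 (k - 1) = -1 * SS).
    { transitivity (sum_n_m (fun v => -1 * (INR v / INR k * - ln (Gamma (INR v / INR k)))) 1 (k - 1)).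
      - apply sum_n_m_ext. intros v. real_eq. ring.
      - exact (sum_n_m_mult_l (K := R_Ring) (-1) _ 1 (k - 1)). }
    rewrite ES.
    match goal with |- is_lim_seq _ (Finite ?x) => replace x with
      (/ INR k * / 12 - / INR k * ln A + (INR k + 1) / 2 * 0 + SS
       + (INR k / 4 * ln (2 * PI) - INR k * ln A - / (12 * INR k) * ln (INR k)))
       by (generalize SS; intros SS'; field; lra) end.
    apply is_lim_seq_plus'; [| apply is_lim_seq_const].
    apply is_lim_seq_plus'; [| exact L4].
    apply is_lim_seq_plus'; [apply is_lim_seq_minus' |].
    + exact (is_lim_seq_scal_l _ (/ INR k) (/ 12) L1).
    + exact (is_lim_seq_scal_l _ (/ INR k) (ln A) L2).
    + exact (is_lim_seq_scal_l _ ((INR k + 1) / 2) 0 L3).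
Qed.

(** For every candidate F the ratio converges; its limit is 1 exactly when ln F is
    log_fact_const, which yields both existence and uniqueness of the constant. *)
Lemma prod_fact_ratio_limit (zeta : C -> C) (k : nat) (F : R) :
  is_riemann_zeta zeta -> (1 <= k)%nat -> 0 < F ->
  is_lim_seq (fun n => prod_fact k n / prod_fact_asym (glaisher zeta) F k n)
    (exp (log_fact_const (glaisher zeta) k - ln F)).
Proof.
  intros Hz Hk HF. apply is_lim_seq_incr_1.
  assert (HA : 0 < glaisher zeta) by apply exp_pos.
  apply is_lim_seq_ext with (fun n => exp (ln (prod_fact k (S n))
     - ln (prod_fact_asym (glaisher zeta) 1 k (S n)) - ln F)).
  - intros n.
    destruct (ln_prod_fact_asym (glaisher zeta) 1 k (S n) HA Rlt_0_1 Hk ltac:(lia)) as [P1 E1].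
    destruct (ln_prod_fact_asym (glaisher zeta) F k (S n) HA HF Hk ltac:(lia)) as [P2 E2].
    rewrite ln_1 in E1.
    replace (ln (prod_fact k (S n)) - ln (prod_fact_asym (glaisher zeta) 1 k (S n)) - ln F)
      with (ln (prod_fact k (S n)) - ln (prod_fact_asym (glaisher zeta) F k (S n))) by (rewrite E1, E2; ring).
    rewrite <- ln_div by (auto; apply prod_fact_pos).
    apply exp_ln. apply Rdiv_lt_0_compat; auto. apply prod_fact_pos.
  - apply is_lim_seq_continuous.
    + apply derivable_continuous_pt, derivable_pt_exp.
    + apply is_lim_seq_minus'; [now apply prod_fact_log_limit | apply is_lim_seq_const].
Qed.

Theorem theorem3p2 (zeta : C -> C) (Hzeta : is_riemann_zeta zeta)
    (k : nat) (Hk : (1 <= k)%nat) :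
  ln (fact_const (glaisher zeta) k) =
    - (INR k + 1 / INR k) * ln (glaisher zeta)
    + 1 / (12 * INR k)
    - 1 / (12 * INR k) * ln (INR k)
    + INR k / 4 * ln (2 * PI)
    - sum_n_m (fun nu : nat => INR nu / INR k * ln (Gamma (INR nu / INR k)))
        1 (k - 1).
Proof.
  change (ln (fact_const (glaisher zeta) k) = log_fact_const (glaisher zeta) k).
  assert (Hex : exists F, is_fact_const (glaisher zeta) k F).
  { exists (exp (log_fact_const (glaisher zeta) k)). split; [apply exp_pos |].
    assert (L := prod_fact_ratio_limit zeta k _ Hzeta Hk (exp_pos (log_fact_const (glaisher zeta) k))).
    rewrite ln_exp, Rminus_diag, exp_0 in L. exact L. }
  destruct (epsilon_spec (inhabits 0) _ Hex) as [HF HL].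
  fold (fact_const (glaisher zeta) k) in HF, HL.
  assert (L := prod_fact_ratio_limit zeta k _ Hzeta Hk HF).
  assert (E := is_lim_seq_unique _ _ L). rewrite (is_lim_seq_unique _ _ HL) in E.
  injection E as E. rewrite <- exp_0 in E. apply exp_inv in E. lra.
Qed.
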